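(* Let $A\sim\mathcal L_A$ and $B\sim\mathcal L_B$ be random matrices of sizes $m\times n$ and $n\times d$ respectively, whose elements $A_{ij}$, $B_{jk}$ ($i\in[m]$, $j\in[n]$, $k\in[d]$) are independent random variables with $\mathbb E[\|A_{:,j}\|_2^2]$ and $\mathbb E[\|B_{j,:}\|_2^2]$ finite and nonzero for all $j\in[n]$. Let $f:\mathbb R\to\mathbb R$ be Lipschitz with Lipschitz constant $C_f$, let $P=f^\odot(AB)$ (entrywise application of $f$), let $M\ge1$ be an integer, and use the uniform sampling distribution $\xi^u_j=1/n$, $j\in[n]$. With $\hat P_l$, $\hat Y_l$, $\hat P$, $\bar\mu$, $\bar\nu$ and the complexities as defined in the context, put $$c_1=C_f(n\bar\nu+\bar\mu)^{1/2},\qquad c_2=2C_f^2(M+1)(n\bar\nu+\bar\mu)+2\mathbb V_{\Vert}[\mathrm{vec}(f^\odot(AB))],\qquad c_3=md(1+M^{-1}).$$ Then for all $l\ge0$, $L\ge0$, $N_l\ge1$ and $N\ge1$: (i) $\|\mathrm{vec}(\mathbb E[\hat P_l-P])\|_2^2\le c_1^2M^{-l}$; (ii) $\mathbb V_{\Vert}[\mathrm{vec}(\hat Y_l)]\le c_2N_l^{-1}M^{-l}$ and $\mathbb V_{\Vert}[\mathrm{vec}(\hat P)]\le c_2N^{-1}$; (iii) the complexity of $\hat Y_l$ satisfies $C_l\le c_3N_lM^l$ and the complexity of $\hat P$ satisfies $C(\hat P)\le c_3NM^L$.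
   Context: Notation: $[n]=\{1,\dots,n\}$; $(f^\odot(X))_{ik}=f(X_{ik})$. $A_{:,j}$ is the $j$th column of $A$ and $B_{j,:}$ the $j$th row of $B$. $\mathrm{vec}(X)$ is the column concatenation of a matrix $X$ into a vector, and for a random matrix $X$, $\mathbb V_{\Vert}[\mathrm{vec}(X)]:=\mathbb E[\|\mathrm{vec}(X-\mathbb E[X])\|_2^2]$. For $l\ge0$, draw $M^l$ i.i.d. indices $r_1,\dots,r_{M^l}$ uniformly from $[n]$ (with replacement, independently of $A,B$), and set $$Z_l(\xi^u)=\frac n{M^l}\sum_{i=1}^{M^l}A_{:,r_i}B_{r_i,:},\qquad\hat P_l=f^\odot(Z_l(\xi^u)).$$ $\mathbb E$ denotes expectation with respect to the joint law of $A$, $B$ and the sampled indices. Level estimators: $\hat Y_0=\frac1{N_0}\sum_{k=1}^{N_0}\hat P_0^{(k)}$ and, for $l\ge1$, $\hat Y_l=\frac1{N_l}\sum_{k=1}^{N_l}(\hat P_l^{(k)}-\hat P_{l-1}^{(k)})$, where the $N_l$ realisations are independent, and in the $k$-th one $\hat P_l^{(k)}$ and $\hat P_{l-1}^{(k)}$ are built from the same sample of $(A,B)$ and the same index sequence $(r_1,\dots,r_{M^l})$: $\hat P_l^{(k)}$ uses all $M^l$ indices and $\hat P_{l-1}^{(k)}$ uses the $M^{l-1}$ indices $r_{jM}$, $j=1,\dots,M^{l-1}$. The standard Monte Carlo estimator at level $L$ is $\hat P=\frac1N\sum_{k=1}^Nf^\odot(Z_L^{(k)}(\xi^u))$ with $Z_L^{(k)}(\xi^u)$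 independent copies of $Z_L(\xi^u)$ (fresh samples of $A$, $B$ and the indices). Constants: with $s_j=\sqrt{\mathbb E[\|A_{:,j}\|_2^2]\,\mathbb E[\|B_{j,:}\|_2^2]}$, $$\bar\mu=\Big(\sum_{j=1}^ns_j\Big)^2-\mathbb E[\|AB\|_F^2],\qquad\bar\nu=\sum_{i=1}^n\Big(s_i-\frac1n\sum_{j=1}^ns_j\Big)^2.$$ Complexity convention: evaluating one realisation of $Z_l$ costs $mdM^l$, so $C_0=mdN_0$, $C_l=mdN_l(M^l+M^{l-1})$ for $l\ge1$, and $C(\hat P)=mdNM^L$. *)

(* Defs.v *)
From HB Require Import structures.
From mathcomp Require Import all_boot all_order all_algebra.
From mathcomp Require Import all_classical all_reals all_analysis.

Set Implicit Arguments.
Unset Strict Implicit.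
Unset Printing Implicit Defensive.

Import Order.TTheory GRing.Theory Num.Theory.
Import numFieldNormedType.Exports.

Local Open Scope classical_set_scope.
Local Open Scope ring_scope.

Section matrices.
Context {R : realType}.

(* Entrywise 2-norm: the Euclidean norm of a row or column vector, the
   Frobenius norm of a matrix. *)
Definition norm2 {m n} (X : 'M[R]_(m, n)) : R :=
  Num.sqrt (\sum_i \sum_j X i j ^+ 2).

(* [mxvec] concatenates rows, hence the transpose. *)
Definition vec {m n} (X : 'M[R]_(m, n)) : 'cV[R]_(n * m) := (mxvec X^T)^T.

End matrices.

Section probability.
Context {disp : measure_display} {T : measurableType disp} {R : realType}.
Variable Pr : probability T R.

Definition random_matrix {m n} (X : T -> 'M[R]_(m, n)) : Prop :=
  forall i j, measurable_fun setT (fun w => X w i j).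

Definition mean {m n} (X : T -> 'M[R]_(m, n)) : 'M[R]_(m, n) :=
  \matrix_(i, j) fine 'E_Pr[fun w => X w i j].

(* The expectation of || vec (X - E X) ||_2 ^ 2, in [0, +oo]. *)
Definition vec_variance {m n} (X : T -> 'M[R]_(m, n)) : \bar R :=
  'E_Pr[fun w => norm2 (vec (X w - mean X)) ^+ 2].

Definition mutually_independent {I : finType} (F : I -> set (set T)) : Prop :=
  forall (J : {set I}) (E : I -> set T), (forall i, i \in J -> F i (E i)) ->
    Pr (\bigcap_(i in [set` J]) E i) = (\prod_(i in J) Pr (E i))%E.

(* The sigma-algebras generated by the single entries of A and of B. *)
Definition entry_events {m n d} (A : T -> 'M[R]_(m, n)) (B : T -> 'M[R]_(n, d))
    (x : 'I_m * 'I_n + 'I_n * 'I_d) : set (set T) :=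
  match x with
  | inl (i, j) => preimage_set_system setT (fun w => A w i j) measurable
  | inr (j, k) => preimage_set_system setT (fun w => B w j k) measurable
  end.

(* The same together with those generated by the indices r 1, ..., r K
   (the index set of the family is 0-based, the sequence r is 1-based). *)
Definition draw_events {m n d K} (A : T -> 'M[R]_(m, n))
    (B : T -> 'M[R]_(n, d)) (r : nat -> T -> 'I_n)
    (x : 'I_m * 'I_n + 'I_n * 'I_d + 'I_K) : set (set T) :=
  match x with
  | inl e => entry_events A B e
  | inr i => preimage_set_system setT (r i.+1) setT
  end.

Definition uniform_index {n} (r : T -> 'I_n) : Prop :=
  forall j, measurable (r @^-1` [set j]) /\
            Pr (r @^-1` [set j]) = (n%:R^-1)%:E.

Definition uniform_indices {n} (K : nat) (r : nat -> T -> 'I_n) : Prop :=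
  forall i, (1 <= i <= K)%N -> uniform_index (r i).

Definition same_entry_laws {m n} (X Y : T -> 'M[R]_(m, n)) : Prop :=
  forall i j (U : set R), measurable U ->
    Pr ((fun w => X w i j) @^-1` U) = Pr ((fun w => Y w i j) @^-1` U).

(* N independent realisations of (A, B, r_1, ..., r_K).  When the entries of A
   and B are independent, mutual independence of the whole family, with the
   marginals prescribed, says that the triples (As k, Bs k, rs k) are
   independent, that (As k, Bs k) has the joint law of (A, B), and that the
   indices are i.i.d. uniform and independent of the matrices. *)
Definition independent_realisations {m n d N} (K : nat)
    (A : T -> 'M[R]_(m, n)) (B : T -> 'M[R]_(n, d))
    (As : 'I_N -> T -> 'M[R]_(m, n)) (Bs : 'I_N -> T -> 'M[R]_(n, d))
    (rs : 'I_N -> nat -> T -> 'I_n) : Prop :=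
  [/\ forall k, random_matrix (As k) /\ random_matrix (Bs k),
      forall k, same_entry_laws (As k) A /\ same_entry_laws (Bs k) B,
      forall k, uniform_indices K (rs k) &
      mutually_independent
        (fun x : 'I_N * ('I_m * 'I_n + 'I_n * 'I_d + 'I_K) =>
           draw_events (As x.1) (Bs x.1) (rs x.1) x.2)].

Section constants.
Context {m n d : nat}.
Variables (A : T -> 'M[R]_(m, n)) (B : T -> 'M[R]_(n, d)).

Definition col_moment (j : 'I_n) : \bar R :=
  'E_Pr[fun w => norm2 (col j (A w)) ^+ 2].

Definition row_moment (j : 'I_n) : \bar R :=
  'E_Pr[fun w => norm2 (row j (B w)) ^+ 2].

Definition s_coef (j : 'I_n) : R :=
  Num.sqrt (fine (col_moment j) * fine (row_moment j)).

Definition mu_bar : R :=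
  (\sum_j s_coef j) ^+ 2 - fine 'E_Pr[fun w => norm2 (A w *m B w) ^+ 2].

Definition nu_bar : R :=
  \sum_i (s_coef i - n%:R^-1 * \sum_j s_coef j) ^+ 2.

End constants.

End probability.

Section estimators.
Context {R : realType} {m n d : nat}.
Variables (f : R -> R) (M : nat).

Definition Z (l : nat) (A : 'M[R]_(m, n)) (B : 'M[R]_(n, d))
    (r : nat -> 'I_n) : 'M[R]_(m, d) :=
  (n%:R / (M ^ l)%:R) *:
    \sum_(1 <= i < (M ^ l).+1) (col (r i) A *m row (r i) B).

Definition P_hat (l : nat) (A : 'M[R]_(m, n)) (B : 'M[R]_(n, d))
    (r : nat -> 'I_n) : 'M[R]_(m, d) := map_mx f (Z l A B r).

Context {T : Type}.

(* For l >= 1 the coarse term reuses the indices r_M, r_2M, ... of the fine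
   one. *)
Definition Y_hat (l N : nat)
    (As : 'I_N -> T -> 'M[R]_(m, n)) (Bs : 'I_N -> T -> 'M[R]_(n, d))
    (rs : 'I_N -> nat -> T -> 'I_n) (w : T) : 'M[R]_(m, d) :=
  N%:R^-1 *: \sum_k
    (let r i := rs k i w in
     match l with
     | 0 => P_hat 0 (As k w) (Bs k w) r
     | l'.+1 => P_hat l (As k w) (Bs k w) r
                - P_hat l' (As k w) (Bs k w) (fun j => r (j * M)%N)
     end).

Definition MC_hat (L N : nat)
    (As : 'I_N -> T -> 'M[R]_(m, n)) (Bs : 'I_N -> T -> 'M[R]_(n, d))
    (rs : 'I_N -> nat -> T -> 'I_n) (w : T) : 'M[R]_(m, d) :=
  N%:R^-1 *: \sum_k P_hat L (As k w) (Bs k w) (fun i => rs k i w).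

End estimators.

(* Cost of one realisation of [Z l]. *)
Definition eval_cost (m d M l : nat) : nat := (m * d * M ^ l)%N.

Definition level_cost (m d M l N : nat) : nat :=
  match l with
  | 0 => N * eval_cost m d M 0
  | l'.+1 => N * (eval_cost m d M l + eval_cost m d M l')
  end%N.

Definition MC_cost (m d M L N : nat) : nat := (N * eval_cost m d M L)%N.

(* Main.v *)
(* Let V = n nu + mu = n sum_j s_j^2 - E|AB|^2.  Conditionally on (A, B) the
   sampled product Z is the mean of K i.i.d. unbiased estimators of AB, whence
   E|Z - AB|^2 = V / K.  Since f is Lipschitz this bounds the bias and the
   variance of f(Z) - f(AB); the coarse and the fine levels are compared through
   AB, and for a single level V(X) <= 2 V(Y) + 2 E|X - Y|^2 is used with
   Y = f(AB).  Averaging independent realisations divides variances by N.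

   Independence enters only through the joint law of finitely many real
   variables: two families whose laws agree on boxes give the same integrals, so
   an independent family may be replaced by a copy living on a product space,
   where Tonelli and Fubini apply. *)

Require Import Defs.
From HB Require Import structures.
From mathcomp Require Import all_boot all_order all_algebra.
From mathcomp Require Import all_classical all_reals all_analysis.

From mathcomp Require Import measurable_realfun ring lra.

Set Implicit Arguments.
Unset Strict Implicit.
Unset Printing Implicit Defensive.

Import Order.TTheory GRing.Theory Num.Theory.
Import numFieldNormedType.Exports.

Local Open Scope classical_set_scope.
Local Open Scope ring_scope.

(** Both [f] and the squared norm act entry by entry, so every estimate is proved for one entry (a,
    b) and summed at the end. Encoding an index [j] as the real [j%:R] turns a whole draw, matrices
    and indices together, into one finite family of real variables with a single notion of
    independence. Conditioning on (A, B) then needs no conditional expectation: it is the inner part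
    of an iterated integral in which the matrices are frozen. Per entry, K times the mean square
    error of the sample is n sum_j E[(A_aj B_jb)^2] - E[(AB)_ab^2]. This also shows n nu + mu >= 0,
    which the formula hides and the square root in c_1 requires. In c_2 the factor M + 1 is (M^-l +
    M^-(l-1)) / M^-l, from the two sample sizes of a level difference; each factor 2 comes from a
    parallelogram identity; the variance of f(AB) serves the single-level estimators. *)

Definition boxes (I : finType) (R : realType) : set_system (I -> R) :=
  [set B | exists2 U : I -> set R, forall i, measurable (U i) &
           B = [set x | forall i, U i (x i)]].

(** The product sigma-algebra, generated by boxes: they are stable under intersection, and
    independence is a statement about their probabilities. *)
Definition rvec (I : finType) (R : realType) :=
  g_sigma_algebraType (@boxes I R).

Section rvec_measurable.
Variables (I : finType) (R : realType).

HB.instance Definition _ := gen_eqMixin (rvec I R).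
HB.instance Definition _ := gen_choiceMixin (rvec I R).
HB.instance Definition _ := isPointed.Build (rvec I R) (fun=> 0).
HB.instance Definition _ :=
  @isMeasurable.Build (sigma_display (@boxes I R)) (rvec I R)
    <<s @boxes I R >> (@sigma_algebra0 _ setT (@boxes I R))
    (@sigma_algebraC (I -> R) (@boxes I R))
    (@sigma_algebra_bigcup _ setT (@boxes I R)).

Lemma setI_closed_boxes : setI_closed (@boxes I R).
Proof.
move=> _ _ [U mU ->] [V mV ->]; exists (fun i => U i `&` V i).
  by move=> i; exact: measurableI.
by apply/seteqP; split=> [x [Ux Vx] i|x UVx]; [|split=> i; have [] := UVx i].
Qed.

Lemma measurable_coord (i : I) :
  measurable_fun setT (fun x : rvec I R => x i).
Proof.
move=> _ U mU; rewrite setTI; apply: sub_sigma_algebra.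
exists (fun j => if j == i then U else setT); first by move=> j; case: ifP.
apply/seteqP; split=> [x Ux j|x /(_ i)]; last by rewrite eqxx.
by case: eqP => // ->.
Qed.

Lemma measurable_rvec d (T : measurableType d) (X : I -> T -> R) :
  (forall i, measurable_fun setT (X i)) ->
  measurable_fun setT (fun w => X ^~ w : rvec I R).
Proof.
move=> mX; apply: (@measurability _ _ T (rvec I R) setT _ (@boxes I R)) => //.
move=> _ [_ [U mU ->] <-]; rewrite setTI.
have -> : (fun w => X ^~ w : rvec I R) @^-1` [set x | forall i, U i (x i)] =
          \bigcap_(i in setT) (X i @^-1` U i).
  by apply/seteqP; split=> [w h i _|w h i]; [exact: h|exact: (h i Logic.I)].
apply: fin_bigcap_measurable; first exact: finite_finset.
by move=> i _; rewrite -[X in measurable X]setTI; exact: mX.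
Qed.

End rvec_measurable.

(** * Joint laws and independence *)

Section joint_laws.
Local Open Scope ereal_scope.
Context {d d'} {T : measurableType d} {T' : measurableType d'} {R : realType}.
Variables (P : probability T R) (P' : {measure set T' -> \bar R}).

(** The two pushforwards agree on an intersection-stable generator and the first is finite, so they
    coincide. [P'] ranges over measures, in particular over product measures. *)
Lemma eq_integral_law (I : finType) (X : I -> T -> R) (Y : I -> T' -> R)
    (g : rvec I R -> \bar R) :
    (forall i, measurable_fun setT (X i)) ->
    (forall i, measurable_fun setT (Y i)) ->
    (forall U : I -> set R, (forall i, measurable (U i)) ->
      P [set w | forall i, U i (X i w)] = P' [set w | forall i, U i (Y i w)]) ->
    measurable_fun setT g ->
  \int[P]_w g (X ^~ w) = \int[P']_w g (Y ^~ w).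
Proof.
move=> mX mY XY mg.
have mX' := measurable_rvec mX; have mY' := measurable_rvec mY.
pose X' : {mfun T >-> rvec I R} :=
  HB.pack (fun w => X ^~ w : rvec I R) (isMeasurableFun.Build _ _ _ _ _ mX').
pose Y' : {mfun T' >-> rvec I R} :=
  HB.pack (fun w => Y ^~ w : rvec I R) (isMeasurableFun.Build _ _ _ _ _ mY').
have eq_push B : measurable B -> pushforward P X' B = pushforward P' Y' B.
  apply: (@measure_unique _ R (rvec I R) (@boxes I R) (fun=> setT) _ _ _ _
    (pushforward P X') (pushforward P' Y')) => //.
  - exact: setI_closed_boxes.
  - by move=> _; exists (fun=> setT) => //; apply/seteqP.
  - by apply/seteqP; split=> // x _; exists 0%N.
  - by move=> _ [U mU ->]; rewrite /= /pushforward; exact: XY.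
  - by move=> _; rewrite /= /pushforward preimage_setT probability_setT ltry.
have ge0_case h : measurable_fun setT h -> (forall x, 0 <= h x) ->
    \int[P]_w h (X ^~ w : rvec I R) = \int[P']_w h (Y ^~ w : rvec I R).
  move=> mh h0.
  rewrite -(ge0_integral_pushforward mX' P measurableT mh)//.
  rewrite -(ge0_integral_pushforward mY' P' measurableT mh)//.
  apply: (@eq_measure_integral _ _ _ _ (pushforward P' Y') (pushforward P X')).
  by move=> B mB _; exact: eq_push.
(* The integral of a signed [g] is the difference of those of its positive and negative parts, so
   the nonnegative case suffices. *)
have posE S (Z : S -> rvec I R) : (fun w => g (Z w))^\+ = fun w => g^\+ (Z w).
  exact: (funepos_comp g Z).
have negE S (Z : S -> rvec I R) : (fun w => g (Z w))^\- = fun w => g^\- (Z w).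
  exact: (funeneg_comp g Z).
rewrite [LHS]integralE [RHS]integralE.
rewrite (posE T (fun w => X ^~ w)) (posE T' (fun w => Y ^~ w)).
rewrite (negE T (fun w => X ^~ w)) (negE T' (fun w => Y ^~ w)).
congr (_ - _); first exact: (ge0_case _ (measurable_funepos mg)).
exact: (ge0_case _ (measurable_funeneg mg)).
Qed.

End joint_laws.

Section independent_variables.
Local Open Scope ereal_scope.
Context {d} {T : measurableType d} {R : realType}.
Variable P : probability T R.

Lemma expectationE (X : T -> R) : 'E_P[X] = \int[P]_w (X w)%:E.
Proof. by rewrite unlock. Qed.

(** Only the full index set appears: taking some [U i] to be [setT] recovers every subfamily. *)
Definition independent_rvs (I : finType) (X : I -> T -> R) : Prop :=
  forall U : I -> set R, (forall i, measurable (U i)) ->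
    P [set w | forall i, U i (X i w)] = \prod_i P (X i @^-1` U i).

Lemma mutually_independent_rvs (I : finType) (F : I -> set (set T))
    (X : I -> T -> R) :
    mutually_independent P F ->
    (forall i, preimage_set_system setT (X i) measurable `<=` F i) ->
  independent_rvs X.
Proof.
move=> indF XF U mU.
have := indF [set: I]%SET (fun i => X i @^-1` U i).
have -> : \bigcap_(i in [set` [set: I]%SET]) (X i @^-1` U i) =
          [set w | forall i, U i (X i w)].
  by apply/seteqP; split=> [w h i|w h i _]; [apply: h; rewrite /= inE|exact: h].
move=> ->; first by apply: eq_bigl => i; rewrite inE.
by move=> i _; apply: XF; exists (U i) => //; rewrite setTI.
Qed.

Lemma independent_rvs_inj (I J : finType) (X : I -> T -> R) (h : J -> I) :
  injective h -> independent_rvs X -> independent_rvs (fun j => X (h j)).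
Proof.
move=> injh indX U mU.
(* Coordinates outside the image of [h] get the condition [setT], of probability 1, and drop out of
   the product. *)
pose V i := if [pick j | h j == i] is Some j then U j else setT.
have Vh j : V (h j) = U j.
  rewrite /V; case: pickP => [j' /eqP/injh -> //|/(_ j)].
  by rewrite eqxx.
have VN i : i \notin codom h -> V i = setT.
  rewrite /V; case: pickP => [j /eqP <-|//].
  by rewrite codom_f.
have mV i : measurable (V i) by rewrite /V; case: pickP.
have -> : [set w | forall j, U j (X (h j) w)] = [set w | forall i, V i (X i w)].
  apply/seteqP; split=> w /= H.
    move=> i; have [/codomP[j ->]|/VN -> //] := boolP (i \in codom h).
    by rewrite Vh.
  by move=> j; rewrite -Vh.
rewrite indX// (bigID (mem (codom h)))/= [X in _ * X]big1 ?mule1; last first.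
  by move=> i /VN ->; rewrite preimage_setT probability_setT.
rewrite (eq_bigl (mem (h @: [set: J])%SET)); last first.
  move=> i /=; apply/codomP/imsetP => [[j ->]|[j _ ->]]; last by exists j.
  by exists j => //; rewrite inE.
rewrite big_imset/=; last by move=> i j _ _; exact: injh.
by apply: eq_big => [j|j _]; rewrite ?inE// Vh.
Qed.

(** The [inl] and the [inr] variables read different coordinates of the product space, so the two
    groups are independent by construction. *)
Definition decoupled (I J : finType) (X : I + J -> T -> R) (x : I + J)
    (w : T * T) : R :=
  if x is inl _ then X x w.1 else X x w.2.

Lemma measurable_decoupled (I J : finType) (X : I + J -> T -> R) :
  (forall x, measurable_fun setT (X x)) ->
  forall x, measurable_fun setT (decoupled X x).
Proof.
by move=> mX [i|j]; rewrite /decoupled; apply: measurableT_comp.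
Qed.

Lemma integral_decoupled (I J : finType) (X : I + J -> T -> R)
    (g : rvec (I + J)%type R -> \bar R) :
    (forall x, measurable_fun setT (X x)) -> independent_rvs X ->
    measurable_fun setT g ->
  \int[P]_w g (X ^~ w) = \int[P \x P]_w g (decoupled X ^~ w).
Proof.
move=> mX indX mg; apply: eq_integral_law => //.
  exact: measurable_decoupled.
move=> U mU; rewrite indX// big_sumType/=.
have mbox (K : finType) (h : K -> I + J) :
    measurable [set w | forall k, U (h k) (X (h k) w)].
  have -> : [set w | forall k, U (h k) (X (h k) w)] =
      \bigcap_(k in setT) (X (h k) @^-1` U (h k)).
    by apply/seteqP; split=> [w H k _|w H k]; [exact: H|exact: (H k Logic.I)].
  apply: fin_bigcap_measurable; first exact: finite_finset.
  by move=> k _; rewrite -[X in measurable X]setTI; exact: mX.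
have -> : [set w | forall x, U x (decoupled X x w)] =
    [set w | forall i : I, U (inl i) (X (inl i) w)] `*`
    [set w | forall j : J, U (inr j) (X (inr j) w)].
  apply/seteqP; split=> [w H|w [H1 H2] [i|j]]; [|exact: H1|exact: H2].
  by split=> k; [exact: (H (inl k))|exact: (H (inr k))].
rewrite product_measure1E; [|exact: mbox|exact: mbox].
have injl : injective (inl : I -> I + J) by move=> ? ? [].
have injr : injective (inr : J -> I + J) by move=> ? ? [].
have mUl i : measurable (U (inl i)) by [].
have mUr j : measurable (U (inr j)) by [].
by congr (_ * _); [rewrite -(independent_rvs_inj injl indX mUl)|
  rewrite -(independent_rvs_inj injr indX mUr)].
Qed.

(** The form that replaces conditioning: [w] carries the [inl] variables and is frozen while the
    [inr] variables are integrated over [v]. *)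
Lemma tonelli_decoupled (I J : finType) (X : I + J -> T -> R)
    (g : rvec (I + J)%type R -> \bar R) :
    (forall x, measurable_fun setT (X x)) -> independent_rvs X ->
    measurable_fun setT g -> (forall x, 0 <= g x) ->
  \int[P]_w g (X ^~ w) = \int[P]_w \int[P]_v g (decoupled X ^~ (w, v)).
Proof.
move=> mX indX mg g0; rewrite integral_decoupled// fubini_tonelli1//.
exact: (measurableT_comp mg (measurable_rvec (measurable_decoupled mX))).
Qed.

Lemma expectation_indep_mul (I J : finType) (X : I + J -> T -> R)
    (F : rvec I R -> R) (G : rvec J R -> R) :
    (forall x, measurable_fun setT (X x)) -> independent_rvs X ->
    measurable_fun setT F -> measurable_fun setT G ->
    (fun w => F (fun i => X (inl i) w)) \in Lfun P 1 ->
    (fun w => G (fun j => X (inr j) w)) \in Lfun P 1 ->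
  'E_P[fun w => F (fun i => X (inl i) w) * G (fun j => X (inr j) w)]%R =
  'E_P[fun w => F (fun i => X (inl i) w)] *
  'E_P[fun w => G (fun j => X (inr j) w)].
Proof.
move=> mX indX mF mG.
set FX := (fun w => F _); set GX := (fun w => G _).
move=> FX1 GX1.
have mFG : measurable_fun setT (fun x : rvec (I + J)%type R =>
    (F (fun i => x (inl i)) * G (fun j => x (inr j)))%:E).
  apply/measurable_EFinP/measurable_funM.
    apply: (measurableT_comp mF).
    apply: (@measurable_rvec I R _ _
      (fun i (x : rvec (I + J)%type R) => x (inl i))).
    by move=> i; exact: measurable_coord.
  apply: (measurableT_comp mG).
  apply: (@measurable_rvec J R _ _
    (fun i (x : rvec (I + J)%type R) => x (inr i))).
  by move=> i; exact: measurable_coord.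
have iF := FX1; move/Lfun1_integrable in iF.
have iG := GX1; move/Lfun1_integrable in iG.
have mFX := measurable_int _ iF.
have mGX := measurable_int _ iG.
rewrite [LHS]expectationE (integral_decoupled mX indX mFG) /=.
have m2 : measurable_fun setT (fun w : T * T => (FX w.1 * GX w.2)%:E).
  apply/measurable_EFinP/measurable_funM.
    by apply: (measurableT_comp (f := FX)) => //; exact/measurable_EFinP.
  by apply: (measurableT_comp (f := GX)) => //; exact/measurable_EFinP.
transitivity (\int[P \x P]_w (FX w.1 * GX w.2)%:E).
  by apply: eq_integral => -[w v].
(* Fubini requires integrability on the product space; by Tonelli the integral of |F G| is the
   product of two finite integrals. *)
rewrite -integral12_prod_meas1; last first.
  apply/integrable12ltyP => //=.
  have -> : (fun x => \int[P]_y `|(FX x * GX y)%:E|) =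
      (fun x => `|FX x|%:E * \int[P]_y `|(GX y)%:E|).
    apply/funext => x; rewrite -ge0_integralZl//; last first.
      exact: measurableT_comp.
    by apply: eq_integral => y _; rewrite /= normrM EFinM.
  rewrite ge0_integralZr//; last 2 first.
    apply/measurable_EFinP; apply: measurableT_comp => //.
    exact/measurable_EFinP.
    exact: integral_ge0.
  move/integrableP : iF => [_ iF]; move/integrableP : iG => [_ iG].
  by rewrite lte_mul_pinfty// ?integral_ge0// ge0_fin_numE ?integral_ge0.
transitivity (\int[P]_x ((FX x)%:E * 'E_P[GX])).
  apply: eq_integral => x _; rewrite expectationE -integralZl//.
have /fineK <- := expectation_fin_num GX1.
by rewrite integralZr// [X in _ = X * _]expectationE.
Qed.

End independent_variables.

(** * Square-integrable variables *)

Section square_integrable.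
Local Open Scope ereal_scope.
Context {d} {T : measurableType d} {R : realType}.
Variable P : probability T R.
Implicit Types X Y : T -> R.

Lemma Lfun_measurable X p : X \in Lfun P p -> measurable_fun setT X.
Proof. by rewrite inE => /andP[/[!inE]]. Qed.

Lemma Lfun2P X : measurable_fun setT X ->
  'E_P[fun w => X w ^+ 2]%R < +oo -> X \in Lfun P 2%:E.
Proof.
move=> mX X2; rewrite inE; apply/andP; split; rewrite inE//=.
rewrite /finite_norm unlock /Lnorm poweR_lty//; move: X2; rewrite expectationE.
suff <- : \int[P]_w (X w ^+ 2)%:E = \int[P]_w (`|X w| `^ 2)%:E by [].
apply: eq_integral => w _; by rewrite -real_normK ?num_real// -powR_mulrn.
Qed.

Lemma Lfun2_Lfun1 X : X \in Lfun P 2%:E -> X \in Lfun P 1.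
Proof. by apply: Lfun_subset12; rewrite fin_num_measure. Qed.

Lemma Lfun2_sqr X : X \in Lfun P 2%:E -> (fun w => X w ^+ 2)%R \in Lfun P 1.
Proof. by move=> X2; apply/Lfun1_integrable; exact: Lfun2_integrable_sqr. Qed.

Lemma Lfun_const c : (fun=> c : R) \in Lfun P 2%:E.
Proof. exact: (Lfun_cst P c 2). Qed.

Lemma Lfun2D X Y : X \in Lfun P 2%:E -> Y \in Lfun P 2%:E ->
  (fun w => X w + Y w)%R \in Lfun P 2%:E.
Proof. by move=> X2 Y2; rewrite (_ : (fun w => _) = X + Y)%R // rpredD ?lee1n. Qed.

Lemma Lfun2B X Y : X \in Lfun P 2%:E -> Y \in Lfun P 2%:E ->
  (fun w => X w - Y w)%R \in Lfun P 2%:E.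
Proof. by move=> X2 Y2; rewrite (_ : (fun w => _) = X - Y)%R // rpredB ?lee1n. Qed.

Lemma Lfun2Z c X : X \in Lfun P 2%:E -> (fun w => c * X w)%R \in Lfun P 2%:E.
Proof.
move=> X2; rewrite (_ : (fun w => _) = c \o* X); last first.
  by apply/funext => w /=; rewrite mulrC.
by apply: Lfun_scale => //; rewrite ler1n.
Qed.

Lemma Lfun2_sum I (s : seq I) (X : I -> T -> R) :
  (forall i, X i \in Lfun P 2%:E) ->
  (fun w => \sum_(i <- s) X i w)%R \in Lfun P 2%:E.
Proof.
move=> X2; elim: s => [|i s IHs].
  by under eq_fun do rewrite big_nil; exact: Lfun_const.
by under eq_fun do rewrite big_cons; exact: Lfun2D.
Qed.

Lemma le_expectation_sqr X Y c :
    measurable_fun setT X -> measurable_fun setT Y ->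
    (forall w, `|X w| <= c * `|Y w|)%R ->
  'E_P[fun w => X w ^+ 2]%R <= (c ^+ 2)%:E * 'E_P[fun w => Y w ^+ 2]%R.
Proof.
move=> mX mY XY; rewrite !expectationE -ge0_integralZl//=; first last.
- by rewrite lee_fin sqr_ge0.
- by move=> w _; rewrite lee_fin sqr_ge0.
- by apply/measurable_EFinP; exact: measurable_funX.
apply: ge0_le_integral => //.
- by move=> w _; rewrite lee_fin sqr_ge0.
- by apply/measurable_EFinP; exact: measurable_funX.
- apply/measurable_EFinP; apply: measurable_funM => //.
  exact: measurable_funX.
move=> w _; rewrite -EFinM lee_fin -exprMn -[leLHS]real_normK ?num_real//.
(* The sign of [c] is not given, so the comparison is with [|c| * |Y w|]. *)
rewrite -[leRHS]real_normK ?num_real// lerXn2r ?nnegrE// normrM.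
by apply: (le_trans (XY w)); rewrite ler_wpM2r// ler_norm.
Qed.

(** Nonnegativity of the variance; this turns mean square errors into bounds on the bias. *)
Lemma sqr_expectation_le X : X \in Lfun P 2%:E ->
  (fine 'E_P[X] ^+ 2 <= fine 'E_P[fun w => X w ^+ 2])%R.
Proof.
move=> X2; have := variance_ge0 P X; rewrite varianceE//.
rewrite -(fineK (expectation_fin_num (Lfun2_Lfun1 X2))).
by rewrite -(fineK (expectation_fin_num (Lfun2_sqr X2))) -EFinB lee_fin subr_ge0.
Qed.

Lemma variance_le_sqr X : X \in Lfun P 2%:E ->
  'V_P[X] <= 'E_P[fun w => X w ^+ 2]%R.
Proof.
move=> X2; rewrite varianceE//.
rewrite -(fineK (expectation_fin_num (Lfun2_Lfun1 X2))).
by rewrite leeBlDr ?fin_numX// leeDl// -EFin_expe lee_fin sqr_ge0.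
Qed.

(* [V(X + D) + V(X - D) = 2 V(X) + 2 V(D)] with [D = Y - X]. *)
Lemma variance_le_near X Y : X \in Lfun P 2%:E -> Y \in Lfun P 2%:E ->
  'V_P[Y] <= 2%:E * 'V_P[X] + 2%:E * 'E_P[fun w => (Y w - X w) ^+ 2]%R.
Proof.
move=> X2 Y2; have D2 := Lfun2B Y2 X2.
set D := (fun w => Y w - X w)%R in D2 *.
have YE : Y = (X \+ D)%R by apply/funext => w; rewrite /D /= addrC subrK.
rewrite [in leLHS]YE.
apply: (@le_trans _ _ (2%:E * 'V_P[X] + 2%:E * 'V_P[D])); last first.
  rewrite leeD2l// lee_wpmul2l ?lee_fin//; exact: (variance_le_sqr D2).
have := variance_ge0 P (X \- D)%R.
rewrite varianceB// varianceD//.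
have Vf Z : Z \in Lfun P 2%:E -> 'V_P[Z] = (fine 'V_P[Z])%:E.
  by move=> Z2; rewrite fineK// variance_fin_num.
have Cf : covariance P X D \is a fin_num.
  by rewrite covariance_fin_num ?Lfun2_mul_Lfun1// Lfun2_Lfun1.
rewrite (Vf X)// (Vf D)// -(fineK Cf) -!EFinM -!EFinD !lee_fin; lra.
Qed.

Lemma variance_sum_uncorrelated (I : eqType) (s : seq I) (X : I -> T -> R) :
    uniq s -> (forall i, X i \in Lfun P 2%:E) ->
    (forall i j, i != j -> covariance P (X i) (X j) = 0) ->
  'V_P[fun w => \sum_(i <- s) X i w]%R = \sum_(i <- s) 'V_P[X i].
Proof.
move=> + X2 X0; elim: s => [_|i s IHs /= /andP[iNs us]].
  rewrite big_nil (_ : (fun w => _) = cst 0%R) ?variance_cst//.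
  by apply/funext => w; rewrite big_nil.
have C0 : covariance P (X i) (fun w => \sum_(j <- s) X j w)%R = 0.
  elim: s iNs {IHs us} => [_|j s IHs].
    rewrite (_ : (fun w => _) = cst 0%R) ?covariance_cst_r//.
    by apply/funext => w; rewrite big_nil.
  rewrite inE negb_or => /andP[ij iNs].
  rewrite (_ : (fun w => _) = X j \+ (fun w => \sum_(j <- s) X j w)%R)%R.
    by rewrite covarianceDr ?X2 ?Lfun2_sum// X0// IHs// adde0.
  by apply/funext => w; rewrite big_cons.
rewrite (_ : (fun w => _) = X i \+ (fun w => \sum_(j <- s) X j w)%R)%R.
  by rewrite varianceD ?Lfun2_sum// C0 mule0 adde0 big_cons IHs.
by apply/funext => w; rewrite big_cons.
Qed.

Lemma variance_mean_uncorrelated (I : finType) (c : R) (X : I -> T -> R) :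
    (forall i, X i \in Lfun P 2%:E) ->
    (forall i j, i != j -> covariance P (X i) (X j) = 0) ->
  'V_P[fun w => c * \sum_i X i w]%R = (c ^+ 2)%:E * \sum_i 'V_P[X i].
Proof.
move=> X2 X0; rewrite -variance_sum_uncorrelated ?index_enum_uniq//.
rewrite -varianceZ; last exact: Lfun2_sum.
by congr variance; apply/funext => w /=; rewrite mulrC.
Qed.

End square_integrable.

(** * Entrywise form of the matrix norms *)

Section matrix_norms.
Context {R : realType}.

Lemma norm2_sqr m n (X : 'M[R]_(m, n)) :
  norm2 X ^+ 2 = \sum_i \sum_j X i j ^+ 2.
Proof.
by rewrite sqr_sqrtr// sumr_ge0// => i _; rewrite sumr_ge0// => j _; rewrite sqr_ge0.
Qed.

Lemma norm2_vec_sqr m n (X : 'M[R]_(m, n)) :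
  norm2 (vec X) ^+ 2 = \sum_i \sum_j X i j ^+ 2.
Proof.
rewrite norm2_sqr exchange_big/= big_ord1 exchange_big/= pair_big/=.
rewrite (reindex _ (curry_mxvec_bij n m))/=; apply: eq_bigr => -[j i] _ /=.
by rewrite mxE mxvecE mxE.
Qed.

End matrix_norms.

(** * Functions of disjoint blocks of an independent family *)

Section independent_blocks.
Local Open Scope ereal_scope.
Context {d} {T : measurableType d} {R : realType}.
Variable P : probability T R.
Context {I : finType} (X : I -> T -> R).
Hypotheses (mX : forall i, measurable_fun setT (X i)).
Hypothesis indX : independent_rvs P X.

(** Disjoint injective blocks combine into one injection of [J1 + J2], which reduces the claim to
    two independent halves. *)
Lemma expectation_mul_blocks (J1 J2 : finType) (h1 : J1 -> I) (h2 : J2 -> I)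
    (F : rvec J1 R -> R) (G : rvec J2 R -> R) :
    injective h1 -> injective h2 -> (forall i j, h1 i <> h2 j) ->
    measurable_fun setT F -> measurable_fun setT G ->
    (fun w => F (fun i => X (h1 i) w)) \in Lfun P 1 ->
    (fun w => G (fun j => X (h2 j) w)) \in Lfun P 1 ->
  'E_P[fun w => F (fun i => X (h1 i) w) * G (fun j => X (h2 j) w)]%R =
  'E_P[fun w => F (fun i => X (h1 i) w)] *
  'E_P[fun w => G (fun j => X (h2 j) w)].
Proof.
move=> inj1 inj2 h12 mF mG.
pose h x := match x with inl i => h1 i | inr j => h2 j end.
have injh : injective h.
  move=> [i|i] [j|j] /= => [/inj1 ->//|/h12//|/esym/h12//|/inj2 ->//].
apply: (@expectation_indep_mul _ _ _ P _ _ (fun x => X (h x)) F G) => //.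
exact: independent_rvs_inj.
Qed.

Lemma covariance_blocks (J1 J2 : finType) (h1 : J1 -> I) (h2 : J2 -> I)
    (F : rvec J1 R -> R) (G : rvec J2 R -> R) :
    injective h1 -> injective h2 -> (forall i j, h1 i <> h2 j) ->
    measurable_fun setT F -> measurable_fun setT G ->
    (fun w => F (fun i => X (h1 i) w)) \in Lfun P 2%:E ->
    (fun w => G (fun j => X (h2 j) w)) \in Lfun P 2%:E ->
  covariance P (fun w => F (fun i => X (h1 i) w))
               (fun w => G (fun j => X (h2 j) w)) = 0.
Proof.
move=> inj1 inj2 h12 mF mG F2 G2.
have F1 := Lfun2_Lfun1 F2; have G1 := Lfun2_Lfun1 G2.
rewrite covarianceE//; last exact: Lfun2_mul_Lfun1.
rewrite [X in X - _](expectation_mul_blocks inj1 inj2)// subee//.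
by rewrite fin_numM ?expectation_fin_num.
Qed.

Lemma expectation_mul_sqr (i j : I) : i != j ->
    X i \in Lfun P 2%:E -> X j \in Lfun P 2%:E ->
  'E_P[fun w => (X i w * X j w) ^+ 2]%R =
  'E_P[fun w => X i w ^+ 2]%R * 'E_P[fun w => X j w ^+ 2]%R.
Proof.
move=> ij Xi Xj.
have msq : measurable_fun setT (fun x : rvec unit R => x tt ^+ 2)%R.
  by apply: measurable_funX; exact: measurable_coord.
have -> : (fun w => (X i w * X j w) ^+ 2)%R =
          (fun w => X i w ^+ 2 * X j w ^+ 2)%R.
  by apply/funext => w; rewrite exprMn.
apply: (@expectation_mul_blocks unit unit (fun=> i) (fun=> j)
  (fun x => x tt ^+ 2)%R (fun x => x tt ^+ 2)%R) => //.
- by move=> [] [].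
- by move=> [] [].
- by move=> _ _; exact/eqP.
- exact: Lfun2_sqr.
- exact: Lfun2_sqr.
Qed.

(** In general a product of square-integrable factors is only integrable; here independence makes
    its second moment factor, so it is finite. *)
Lemma Lfun2_mul (i j : I) : i != j ->
    X i \in Lfun P 2%:E -> X j \in Lfun P 2%:E ->
  (fun w => X i w * X j w)%R \in Lfun P 2%:E.
Proof.
move=> ij Xi Xj; apply: Lfun2P; first exact: measurable_funM.
rewrite expectation_mul_sqr//.
have := Lfun2_sqr Xi; have := Lfun2_sqr Xj => /expectation_fin_num fj.
move=> /expectation_fin_num fi.
rewrite -ge0_fin_numE ?fin_numM// mule_ge0// expectation_ge0// => w;
exact: sqr_ge0.
Qed.

End independent_blocks.

(** * Sampling of the indices *)

Section uniform_indices.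
Local Open Scope ereal_scope.
Context {d} {T : measurableType d} {R : realType}.
Variable P : probability T R.
Context {n : nat}.

(** Decoding of an index stored as a real: the sum of indicators is a measurable function on all of
    [R] and returns [c i] at [i%:R]. *)
Lemma sum_indic_index (i : 'I_n) (c : 'I_n -> R) :
  (\sum_j c j * \1_[set j%:R] (i%:R : R) = c i)%R.
Proof.
rewrite (bigD1 i)//= indicE mem_set//= mulr1 big1 ?addr0// => j ji.
rewrite indicE memNset ?mulr0//= => /eqP.
by rewrite eqr_nat => /eqP/val_inj ij; rewrite ij eqxx in ji.
Qed.

Lemma fun_index_sum (rho : T -> 'I_n) (c : 'I_n -> R) (w : T) :
  c (rho w) = (\sum_j c j * \1_(rho @^-1` [set j]) w)%R.
Proof.
rewrite (bigD1 (rho w))//= indicE mem_set//= mulr1 big1 ?addr0// => j jr.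
by rewrite indicE memNset ?mulr0// => rj; rewrite -rj eqxx in jr.
Qed.

(** [uniform_index] makes the fibres of [rho] measurable, so [c (rho w)] is a finite combination of
    indicators of events. *)
Lemma Lfun2_index (rho : T -> 'I_n) (c : 'I_n -> R) :
  uniform_index P rho -> (fun w => c (rho w)) \in Lfun P 2%:E.
Proof.
move=> urho; under eq_fun do rewrite fun_index_sum.
apply: Lfun2_sum => j; apply: Lfun2Z; have [mj _] := urho j.
apply: Lfun2P; first exact: measurable_indic.
rewrite (_ : (fun w => _) = \1_(rho @^-1` [set j]) :> (T -> R)).
  by rewrite expectation_indic// (le_lt_trans (probability_le1 _ _)) ?ltry.
by apply/funext => w; rewrite indicE; case: (_ \in _); rewrite ?expr1n ?expr0n.
Qed.

Lemma expectation_index (rho : T -> 'I_n) (c : 'I_n -> R) :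
  uniform_index P rho -> 'E_P[fun w => c (rho w)] = (n%:R^-1 * \sum_j c j)%:E.
Proof.
move=> urho; rewrite expectationE.
under eq_integral do rewrite fun_index_sum -sumEFin.
rewrite integral_sum//=; last first.
  move=> j; have [mj _] := urho j; apply/Lfun1_integrable/Lfun2_Lfun1/Lfun2Z.
  rewrite (_ : \1_ _ = fun w => (rho w == j)%:R).
    exact: (Lfun2_index (fun i => (i == j)%:R) urho).
  apply/funext => w; rewrite indicE; congr (_ %:R); congr nat_of_bool.
  by apply/idP/eqP => [/set_mem//|/mem_set].
rewrite mulr_sumr -sumEFin; apply: eq_bigr => j _; have [mj Pj] := urho j.
under eq_integral do rewrite EFinM.
rewrite integralZl//; last first.
  exact: integrable_indic.
rewrite integral_indic// setIT mulrC EFinM; congr (_ * _); exact: Pj.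
Qed.

(** For fixed [c] each n c(rho_i) is unbiased for sum_j c_j with variance n sum_j c_j^2 - (sum_j
    c_j)^2, and the [#|K|] terms are uncorrelated. With c_j = A_aj B_jb this is the conditional mean
    square error of one entry of the sampled product. *)
Lemma variance_index_mean (K : finType) (rho : K -> T -> 'I_n) (c : 'I_n -> R) :
    (0 < #|K|)%N -> (forall i, uniform_index P (rho i)) ->
    independent_rvs P (fun i w => (rho i w)%:R : R) ->
  \int[P]_w ((n%:R / #|K|%:R * (\sum_i c (rho i w)) - \sum_j c j) ^+ 2)%:E =
  (#|K|%:R^-1 * (n%:R * (\sum_j c j ^+ 2) - (\sum_j c j) ^+ 2))%:E.
Proof.
move=> K0 urho indrho.
(* For n = 0 every sum is empty and both sides vanish; otherwise [n%:R] can be cancelled. *)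
have [n0|n0] := posnP n.
  move: c rho urho indrho; rewrite n0 => c rho urho indrho.
  rewrite !big_ord0 expr0n !mul0r !subr0 mulr0.
  under eq_integral do rewrite mul0r subr0 expr0n.
  exact: integral0.
have nN0 : (n%:R != 0 :> R)%R by rewrite pnatr_eq0 -lt0n.
have KN0 : (#|K|%:R != 0 :> R)%R by rewrite pnatr_eq0 -lt0n.
pose Y i w := c (rho i w).
have Y2 i : Y i \in Lfun P 2%:E by exact: Lfun2_index.
have EY i : 'E_P[Y i] = (n%:R^-1 * \sum_j c j)%:E by exact: expectation_index.
have VY i : 'V_P[Y i] =
    (n%:R^-1 * (\sum_j c j ^+ 2) - (n%:R^-1 * \sum_j c j) ^+ 2)%:E.
  rewrite varianceE// EY.
  by have := expectation_index (fun j => c j ^+ 2)%R (urho i) => ->.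
pose dec (x : rvec unit R) : R := (\sum_j c j * \1_[set j%:R] (x tt))%R.
have decE i w : dec (fun=> (rho i w)%:R) = c (rho i w).
  exact: sum_indic_index.
have mdec : measurable_fun setT dec.
  apply: measurable_sum => j; apply: measurable_funM => //.
  have m1 : measurable_fun setT (\1_[set j%:R] : R -> R).
    exact: measurable_indic.
  exact: (measurableT_comp m1 (measurable_coord tt)).
have mrho i : measurable_fun setT (fun w => (rho i w)%:R : R).
  exact: (Lfun_measurable (Lfun2_index (fun j => j%:R) (urho i))).
have C0 i j : i != j -> covariance P (Y i) (Y j) = 0.
  move=> ij.
  (* Independence is stated for the encoded indices, so [Y k] is rewritten as the measurable
     function [dec] of a real. *)
  have YE k : Y k = fun w => dec (fun=> (rho k w)%:R).
    by apply/funext => w; rewrite decE.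
  rewrite !YE.
  apply: (@covariance_blocks _ _ _ P _ _ mrho indrho unit unit
    (fun=> i) (fun=> j) dec dec) => //; rewrite -?YE//.
  - by move=> [] [].
  - by move=> [] [].
  - by move=> _ _; exact/eqP.
pose S w := (n%:R / #|K|%:R * \sum_i Y i w)%R.
have S2 : S \in Lfun P 2%:E by apply: Lfun2Z; exact: Lfun2_sum.
have ES : 'E_P[S] = (\sum_j c j)%:E.
  rewrite expectationE; under eq_integral do rewrite EFinM.
  rewrite integralZl//; last exact/Lfun1_integrable/Lfun2_Lfun1/Lfun2_sum.
  under eq_integral do rewrite -sumEFin.
  rewrite integral_sum//; last by move=> i; exact/Lfun1_integrable/Lfun2_Lfun1.
  rewrite (eq_bigr (fun=> (n%:R^-1 * \sum_j c j)%:E)); last first.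
    by move=> i _; rewrite -(EY i) expectationE.
  rewrite sumEFin sumr_const -EFinM -[(_ *+ #|_|)%R]mulr_natr.
  by congr EFin; field; apply/andP.
transitivity ('V_P[S]).
  rewrite /variance covariance.unlock ES expectationE.
  by apply: eq_integral => w _; rewrite /= expr2.
rewrite variance_mean_uncorrelated//.
rewrite (eq_bigr _ (fun i _ => VY i)) sumEFin sumr_const -EFinM -mulr_natr.
by congr EFin; field; apply/andP.
Qed.

End uniform_indices.

(** * The sampled product for one draw of matrices and indices *)

Section draws.
Context {d0} {T : measurableType d0} {R : realType}.
Variable P : probability T R.
Context {m n d : nat}.
Local Notation entry := ('I_m * 'I_n + 'I_n * 'I_d)%type.

Definition entry_coord (A : T -> 'M[R]_(m, n)) (B : T -> 'M[R]_(n, d))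
    (x : entry) (w : T) : R :=
  match x with inl ij => A w ij.1 ij.2 | inr jk => B w jk.1 jk.2 end.

(* Indices are encoded as reals, so that a draw is a real vector. *)
Definition draw_coord (K : finType) (A : T -> 'M[R]_(m, n))
    (B : T -> 'M[R]_(n, d)) (rho : K -> T -> 'I_n) (x : entry + K) (w : T) : R :=
  match x with inl e => entry_coord A B e w | inr i => (rho i w)%:R end.

Definition product_entry (a : 'I_m) (b : 'I_d) (x : rvec entry R) : R :=
  \sum_j x (inl (a, j)) * x (inr (j, b)).

(** The map [h] selects indices: the identity for the fine level, every M-th index for the coarse
    one, so both levels are functions of one draw. *)
Definition sample_entry (K K' : finType) (h : K' -> K) (a : 'I_m) (b : 'I_d)
    (x : rvec (entry + K)%type R) : R :=
  n%:R / #|K'|%:R * \sum_i \sum_j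
    x (inl (inl (a, j))) * x (inl (inr (j, b))) * \1_[set j%:R] (x (inr (h i))).

Lemma measurable_product_entry a b : measurable_fun setT (product_entry a b).
Proof.
by apply: measurable_sum => j; apply: measurable_funM; exact: measurable_coord.
Qed.

Lemma measurable_sample_entry (K K' : finType) (h : K' -> K) a b :
  measurable_fun setT (sample_entry h a b).
Proof.
apply: measurable_funM => //; apply: measurable_sum => i.
apply: measurable_sum => j; apply: measurable_funM.
  by apply: measurable_funM; exact: measurable_coord.
have m1 : measurable_fun setT (\1_[set j%:R] : R -> R).
  exact: measurable_indic.
exact: (measurableT_comp m1 (measurable_coord _)).
Qed.

Lemma product_entryE A B a b w :
  product_entry a b (entry_coord A B ^~ w) = (A w *m B w) a b.
Proof. by rewrite mxE. Qed.

Lemma sample_entryE (K K' : finType) (h : K' -> K) A B (rho : K -> T -> 'I_n)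
    a b w :
  sample_entry h a b (draw_coord A B rho ^~ w) = n%:R / #|K'|%:R *
    \sum_i A w a (rho (h i) w) * B w (rho (h i) w) b.
Proof.
congr (_ * _); apply: eq_bigr => i _ /=.
by rewrite (sum_indic_index _ (fun j => A w a j * B w j b)).
Qed.

(** Mean conditional variance of the entry (a, b) for a single sampled index; a sample of size K
    divides it by K. *)
Definition sample_gap (A : T -> 'M[R]_(m, n)) (B : T -> 'M[R]_(n, d)) a b : R :=
  n%:R * (\sum_j fine 'E_P[fun w => ((A w a j * B w j b) ^+ 2)%R]) -
  fine 'E_P[fun w => ((A w *m B w) a b ^+ 2)%R].

Section entries.
Variables (A : T -> 'M[R]_(m, n)) (B : T -> 'M[R]_(n, d)).
Hypotheses (mA : random_matrix A) (mB : random_matrix B).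
Hypothesis A2 : forall i j, (fun w => A w i j) \in Lfun P 2%:E.
Hypothesis B2 : forall i j, (fun w => B w i j) \in Lfun P 2%:E.
Hypothesis indE : independent_rvs P (entry_coord A B).

Lemma measurable_entry_coord e : measurable_fun setT (entry_coord A B e).
Proof. by case: e => -[i j]; [exact: mA|exact: mB]. Qed.

Lemma Lfun2_mul_entries a j b : (fun w => A w a j * B w j b) \in Lfun P 2%:E.
Proof.
exact: (@Lfun2_mul _ _ _ _ _ _ measurable_entry_coord indE
  (inl (a, j)) (inr (j, b)) isT (A2 a j) (B2 j b)).
Qed.

Lemma expectation_mul_entries a j b :
  ('E_P[fun w => ((A w a j * B w j b) ^+ 2)%R] =
  'E_P[fun w => (A w a j ^+ 2)%R] * 'E_P[fun w => (B w j b ^+ 2)%R])%E.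
Proof.
exact: (@expectation_mul_sqr _ _ _ _ _ _ measurable_entry_coord indE
  (inl (a, j)) (inr (j, b)) isT (A2 a j) (B2 j b)).
Qed.

Lemma Lfun2_mulmx a b : (fun w => (A w *m B w) a b) \in Lfun P 2%:E.
Proof.
by under eq_fun do rewrite mxE; apply: Lfun2_sum => j; exact: Lfun2_mul_entries.
Qed.

End entries.

Section one_draw.
Variables (A : T -> 'M[R]_(m, n)) (B : T -> 'M[R]_(n, d)).
Variables (K K' : finType) (rho : K -> T -> 'I_n) (h : K' -> K).
Hypotheses (mA : random_matrix A) (mB : random_matrix B).
Hypothesis A2 : forall i j, (fun w => A w i j) \in Lfun P 2%:E.
Hypothesis B2 : forall i j, (fun w => B w i j) \in Lfun P 2%:E.
Hypothesis urho : forall i, uniform_index P (rho i).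
Hypothesis indX : independent_rvs P (draw_coord A B rho).
Hypotheses (K'0 : (0 < #|K'|)%N) (injh : injective h).

Lemma independent_entries : independent_rvs P (entry_coord A B).
Proof.
by apply: (independent_rvs_inj (h := inl) _ indX) => x y [].
Qed.

Lemma measurable_draw_coord x : measurable_fun setT (draw_coord A B rho x).
Proof.
case: x => [e|i]; first exact: measurable_entry_coord.
exact: (Lfun_measurable (Lfun2_index (fun j => j%:R) (urho i))).
Qed.

Let mul2 a j b := Lfun2_mul_entries mA mB A2 B2 independent_entries a j b.

(** With the matrices frozen, the inner integral over the indices is a variance of known value,
    which is then averaged over the matrices. *)
Lemma expectation_sample_sqr a b :
  'E_P[fun w => ((sample_entry h a b (draw_coord A B rho ^~ w)
                 - (A w *m B w) a b) ^+ 2)%R]%E =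
  (#|K'|%:R^-1 * sample_gap A B a b)%:E.
Proof.
pose g (x : rvec (entry + K)%type R) : \bar R :=
  ((sample_entry h a b x - product_entry a b (fun e => x (inl e))) ^+ 2)%:E.
have mg : measurable_fun setT g.
  apply/measurable_EFinP/measurable_funX/measurable_funB.
    exact: measurable_sample_entry.
  apply: (measurableT_comp (measurable_product_entry a b)).
  apply: (@measurable_rvec entry R _ _
    (fun i (x : rvec (entry + K)%type R) => x (inl i))).
  by move=> e; exact: measurable_coord.
have -> : ('E_P[fun w => ((sample_entry h a b (draw_coord A B rho ^~ w)
    - (A w *m B w) a b) ^+ 2)%R])%E = (\int[P]_w g (draw_coord A B rho ^~ w))%E.
  by rewrite expectationE; apply: eq_integral => w _; rewrite /g product_entryE.
rewrite tonelli_decoupled//; last 2 first.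
  exact: measurable_draw_coord.
  by move=> x; rewrite lee_fin sqr_ge0.
have indrho : independent_rvs P (fun i w => (rho (h i) w)%:R : R).
  apply: (@independent_rvs_inj _ _ _ _ _ _ _ (fun i => inr (h i)) _ indX).
  by move=> i j [/injh].
under eq_integral => w _.
  rewrite (eq_integral (fun v => ((n%:R / #|K'|%:R *
    (\sum_i A w a (rho (h i) v) * B w (rho (h i) v) b) -
    \sum_j A w a j * B w j b) ^+ 2)%:E)); last first.
    move=> v _; rewrite /g /sample_entry /product_entry /=.
    congr ((_ * _ - _) ^+ 2)%:E; apply: eq_bigr => i _.
    exact: (sum_indic_index _ (fun j => A w a j * B w j b)).
  rewrite (variance_index_mean (fun j => A w a j * B w j b) K'0
    (fun i => urho (h i)) indrho).
  over.
(* Both parts of the inner value are integrable, so the outer expectation of their difference can be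
   split. *)
have i1 : P.-integrable setT (fun w => (\sum_j (A w a j * B w j b) ^+ 2)%:E).
  under eq_fun do rewrite -sumEFin.
  apply: integrable_sum => // j _.
  exact: (Lfun2_integrable_sqr (mul2 _ _ _)).
have i2 : P.-integrable setT (fun w => ((\sum_j A w a j * B w j b) ^+ 2)%:E).
  apply: Lfun2_integrable_sqr.
  by apply: Lfun2_sum => j; exact: mul2.
under eq_integral do rewrite EFinM EFinB EFinM.
rewrite integralZl//; last by apply: integrableB => //; exact: integrableZl.
rewrite integralB//; last exact: integrableZl.
rewrite integralZl// /sample_gap EFinM EFinB; congr (_ * (_ - _))%E.
  rewrite EFinM -sumEFin; congr (_ * _)%E.
  under eq_integral do rewrite -sumEFin.
  rewrite integral_sum//; last first.
    by move=> j; exact: (Lfun2_integrable_sqr (mul2 _ _ _)).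
  apply: eq_bigr => j _; rewrite fineK ?expectationE//.
  by rewrite -expectationE expectation_fin_num// Lfun2_sqr// mul2.
rewrite fineK; last first.
  rewrite expectation_fin_num// Lfun2_sqr//.
  exact: (Lfun2_mulmx mA mB A2 B2 independent_entries).
by rewrite expectationE; apply: eq_integral => w _; rewrite mxE.
Qed.

End one_draw.

Lemma expectation_sum_ge0 (I : Type) (s : seq I) (X : I -> T -> R) :
    (forall i, measurable_fun setT (X i)) -> (forall i w, 0 <= X i w) ->
  ('E_P[fun w => (\sum_(i <- s) X i w)%R])%E = (\sum_(i <- s) 'E_P[X i])%E.
Proof.
move=> mX X0; rewrite expectationE; under eq_integral do rewrite -sumEFin.
rewrite ge0_integral_sum//.
- by apply: eq_bigr => i _; rewrite expectationE.
- by move=> i; exact/measurable_EFinP.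
- by move=> i w _; rewrite lee_fin.
Qed.

(** All terms are nonnegative, so the expectation commutes with the finite sums in the extended
    reals, infinite values included. *)
Lemma vec_varianceE p q (X : T -> 'M[R]_(p, q)) : random_matrix X ->
  vec_variance P X = (\sum_i \sum_j 'V_P[fun w => X w i j])%E.
Proof.
move=> mX; rewrite /vec_variance.
under eq_fun do rewrite norm2_vec_sqr.
have mD i j : measurable_fun setT (fun w => (X w - mean P X) i j ^+ 2).
  under eq_fun do rewrite !mxE.
  by apply: measurable_funX; apply: measurable_funB => //; exact: mX.
rewrite expectation_sum_ge0//; last 2 first.
- by move=> i; apply: measurable_sum => j.
- by move=> i w; rewrite sumr_ge0// => j _; rewrite sqr_ge0.
apply: eq_bigr => i _; rewrite expectation_sum_ge0//; last first.
  by move=> j w; rewrite sqr_ge0.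
apply: eq_bigr => j _; rewrite /variance covariance.unlock.
rewrite [LHS]expectationE [RHS]expectationE.
by apply: eq_integral => w _; rewrite !mxE /= expr2.
Qed.

Section moments.
Variables (A : T -> 'M[R]_(m, n)) (B : T -> 'M[R]_(n, d)).
Hypotheses (mA : random_matrix A) (mB : random_matrix B).

Lemma col_momentE j :
  col_moment P A j = (\sum_a 'E_P[fun w => (A w a j ^+ 2)%R])%E.
Proof.
rewrite /col_moment; under eq_fun do rewrite norm2_sqr.
under eq_fun do under eq_bigr do rewrite big_ord1 mxE.
rewrite expectation_sum_ge0//; last by move=> i w; rewrite sqr_ge0.
by move=> i; apply: measurable_funX; exact: mA.
Qed.

Lemma row_momentE j :
  row_moment P B j = (\sum_b 'E_P[fun w => (B w j b ^+ 2)%R])%E.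
Proof.
rewrite /row_moment; under eq_fun do rewrite norm2_sqr big_ord1.
under eq_fun do under eq_bigr do rewrite mxE.
rewrite expectation_sum_ge0//; last by move=> i w; rewrite sqr_ge0.
by move=> i; apply: measurable_funX; exact: mB.
Qed.

Lemma Lfun2_col_moment i j :
  col_moment P A j \is a fin_num -> (fun w => A w i j) \in Lfun P 2%:E.
Proof.
rewrite fin_numElt => /andP[_ Aoo]; apply: Lfun2P; first exact: mA.
apply: le_lt_trans Aoo; rewrite col_momentE (bigD1 i)//= leeDl// sume_ge0// => k _.
by apply: expectation_ge0 => w; rewrite sqr_ge0.
Qed.

Lemma Lfun2_row_moment j k :
  row_moment P B j \is a fin_num -> (fun w => B w j k) \in Lfun P 2%:E.
Proof.
rewrite fin_numElt => /andP[_ Boo]; apply: Lfun2P; first exact: mB.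
apply: le_lt_trans Boo; rewrite row_momentE (bigD1 k)//= leeDl// sume_ge0// => i _.
by apply: expectation_ge0 => w; rewrite sqr_ge0.
Qed.

End moments.

End draws.

(** * Lipschitz images of square-integrable variables *)

Section lipschitz_functions.
Context {R : realType}.
Variables (f : R -> R) (C : R).
Hypothesis lipf : C.-lipschitz f.

Lemma lipschitzE x y : `|f x - f y| <= C * `|x - y|.
Proof. by have /(_ (x, y) (conj Logic.I Logic.I)) := lipf. Qed.

Lemma lipschitz_measurable : measurable_fun setT f.
Proof.
apply: continuous_measurable_fun => x.
apply/cvgrPdist_lt => e e0.
(* [|C| + 1] is a Lipschitz constant that is positive, hence fit to divide by. *)
have C0 : 0 < `|C| + 1 by rewrite ltr_wpDl.
near=> y; apply: (le_lt_trans (lipschitzE x y)).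
apply: (@le_lt_trans _ _ ((`|C| + 1) * `|x - y|)).
  by rewrite ler_wpM2r// (le_trans (ler_norm C))// lerDl.
rewrite mulrC -ltr_pdivlMr//; near: y.
by apply: (nbhsx_ballx x (e / (`|C| + 1))); rewrite divr_gt0.
Unshelve. all: by end_near. Qed.

Context {d0} {T : measurableType d0}.
Variable P : probability T R.

Lemma expectation_lipschitz_sqr (X Y : T -> R) :
    measurable_fun setT X -> measurable_fun setT Y ->
  ('E_P[fun w => ((f (X w) - f (Y w)) ^+ 2)%R] <=
  (C ^+ 2)%:E * 'E_P[fun w => ((X w - Y w) ^+ 2)%R])%E.
Proof.
move=> mX mY; apply: le_expectation_sqr.
- by apply: measurable_funB; apply: (measurableT_comp lipschitz_measurable).
- exact: measurable_funB.
- by move=> w; exact: lipschitzE.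
Qed.

(** f(X) - f(0) is dominated by C |X|, and the constant f(0) is square-integrable under a
    probability. *)
Lemma Lfun2_lipschitz (X : T -> R) :
  X \in Lfun P 2%:E -> (fun w => f (X w)) \in Lfun P 2%:E.
Proof.
move=> X2; have mX := Lfun_measurable X2.
rewrite (_ : (fun w => _) = fun w => f 0 + (f (X w) - f 0)); last first.
  by apply/funext => w; rewrite addrC subrK.
apply: Lfun2D; first exact: Lfun_const.
apply: Lfun2P.
  by apply: measurable_funB => //; apply: (measurableT_comp lipschitz_measurable).
have := expectation_lipschitz_sqr mX (measurable_cst (0 : R)).
move=> /le_lt_trans; apply.
under [X in ('E_P[X])%E]eq_fun do rewrite subr0.
by rewrite -(fineK (expectation_fin_num (Lfun2_sqr X2))) -EFinM ltry.
Qed.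

End lipschitz_functions.

(** * The constant n nu + mu as a sum over entries *)

Section sampled_estimators.
Context {d0} {T : measurableType d0} {R : realType}.
Variable P : probability T R.
Context {m n d : nat}.
Local Notation entry := ('I_m * 'I_n + 'I_n * 'I_d)%type.

Section constants.
Variables (A : T -> 'M[R]_(m, n)) (B : T -> 'M[R]_(n, d)).
Hypotheses (mA : random_matrix A) (mB : random_matrix B).
Hypothesis finA : forall j, col_moment P A j \is a fin_num.
Hypothesis finB : forall j, row_moment P B j \is a fin_num.
Hypothesis indE : independent_rvs P (entry_coord A B).

Let A2 i j : (fun w => A w i j) \in Lfun P 2%:E.
Proof. exact: Lfun2_col_moment. Qed.

Let B2 j k : (fun w => B w j k) \in Lfun P 2%:E.
Proof. exact: Lfun2_row_moment. Qed.

(** The product of the column and the row moment expands into terms E[A_aj^2] E[B_jb^2], each merged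
    into one second moment by independence. *)
Lemma s_coef_sqr j : s_coef P A B j ^+ 2 =
  \sum_a \sum_b fine ('E_P[fun w => ((A w a j * B w j b) ^+ 2)%R])%E.
Proof.
have fA a : ('E_P[fun w => (A w a j ^+ 2)%R])%E \is a fin_num.
  exact/expectation_fin_num/Lfun2_sqr/A2.
have fB b : ('E_P[fun w => (B w j b ^+ 2)%R])%E \is a fin_num.
  exact/expectation_fin_num/Lfun2_sqr/B2.
rewrite sqr_sqrtr; last first.
  by rewrite mulr_ge0// fine_ge0// expectation_ge0// => w; rewrite sqr_ge0.
rewrite col_momentE// row_momentE// -!sum_fine// mulr_suml.
apply: eq_bigr => a _; rewrite mulr_sumr; apply: eq_bigr => b _.
by rewrite -fineM// -(expectation_mul_entries mA mB A2 B2 indE).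
Qed.

Lemma sum_sample_gap :
  \sum_a \sum_b sample_gap P A B a b = n%:R * nu_bar P A B + mu_bar P A B.
Proof.
have -> : \sum_a \sum_b sample_gap P A B a b =
    n%:R * (\sum_j s_coef P A B j ^+ 2) -
    \sum_a \sum_b fine ('E_P[fun w => ((A w *m B w) a b ^+ 2)%R])%E.
  under eq_bigr do rewrite sumrB.
  rewrite sumrB; congr (_ - _).
  under [in RHS]eq_bigr do rewrite s_coef_sqr.
  rewrite [in RHS]exchange_big/= mulr_sumr; apply: eq_bigr => a _.
  by rewrite exchange_big/= mulr_sumr.
have -> : \sum_a \sum_b fine ('E_P[fun w => ((A w *m B w) a b ^+ 2)%R])%E =
    fine ('E_P[fun w => (norm2 (A w *m B w) ^+ 2)%R])%E.
  have AB2 a b := Lfun2_mulmx mA mB A2 B2 indE a b.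
  under [in RHS]eq_fun do rewrite norm2_sqr.
  have mAB a b : measurable_fun setT (fun w => (A w *m B w) a b ^+ 2).
    exact: (measurable_funX _ (Lfun_measurable (AB2 a b))).
  rewrite expectation_sum_ge0; last 2 first.
  - by move=> a; apply: measurable_sum => b.
  - by move=> a w; rewrite sumr_ge0// => b _; rewrite sqr_ge0.
  have fE a b := expectation_fin_num (Lfun2_sqr (AB2 a b)).
  have sE a : ('E_P[fun w => (\sum_b (A w *m B w) a b ^+ 2)%R] =
      \sum_b 'E_P[fun w => ((A w *m B w) a b ^+ 2)%R])%E.
    by rewrite expectation_sum_ge0// => b w; rewrite sqr_ge0.
  rewrite -sum_fine => [|a _]; last first.
    by rewrite sE sum_fin_num; apply/allP => _ /mapP[b _ ->]; exact: fE.
  by apply: eq_bigr => a _; rewrite sE -sum_fine.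
rewrite /mu_bar addrA; congr (_ - _).
(* n sum_i (s_i - S/n)^2 = n sum_i s_i^2 - S^2, and this S^2 cancels the one in [mu_bar]. *)
rewrite /nu_bar; set S := \sum_j s_coef P A B j; set s := s_coef P A B.
under [in RHS]eq_bigr do rewrite sqrrB.
rewrite big_split/= sumrB sumrMnl -mulr_suml -/S sumr_const card_ord.
(* The identity divides by n; for n = 0 all its terms are zero. *)
have [n0|n0] := posnP n.
  have S0 : S = 0 by rewrite /S big1// => i _; have := ltn_ord i; rewrite {2}n0.
  have nR0 : n%:R = 0 :> R by rewrite n0.
  by rewrite nR0 !mul0r S0 expr0n addr0.
have nN0 : n%:R != 0 :> R by rewrite pnatr_eq0 -lt0n.
by rewrite -[_ *+ n]mulr_natr; field.
Qed.

End constants.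
End sampled_estimators.

(** * Estimators *)

Section estimator_bounds.
Context {d0} {T : measurableType d0} {R : realType}.
Variable P : probability T R.
Context {m n d : nat}.
Local Notation entry := ('I_m * 'I_n + 'I_n * 'I_d)%type.

(** [same_entry_laws] fixes only the marginals; independence within each pair of matrices turns them
    into equal joint laws on boxes. *)
Lemma expectation_same_laws (A A' : T -> 'M[R]_(m, n))
    (B B' : T -> 'M[R]_(n, d)) (g : rvec entry R -> R) :
    random_matrix A -> random_matrix B ->
    random_matrix A' -> random_matrix B' ->
    independent_rvs P (entry_coord A B) ->
    independent_rvs P (entry_coord A' B') ->
    same_entry_laws P A' A -> same_entry_laws P B' B ->
    measurable_fun setT g ->
  ('E_P[fun w => (g (entry_coord A' B' ^~ w))%R] =
   'E_P[fun w => (g (entry_coord A B ^~ w))%R])%E.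
Proof.
move=> mA mB mA' mB' ind ind' lA lB mg; rewrite !expectationE.
apply: (@eq_integral_law _ _ _ _ _ P P entry (entry_coord A' B')
  (entry_coord A B) (fun x => (g x)%:E)).
- exact: measurable_entry_coord.
- exact: measurable_entry_coord.
- move=> U mU; rewrite ind'//.
  apply: etrans _ (esym (ind U mU)); apply: eq_bigr => -[[i j]|[i j]] _.
  + exact: lA.
  + exact: lB.
- exact/measurable_EFinP.
Qed.

Section one_draw_bounds.
Variables (A : T -> 'M[R]_(m, n)) (B : T -> 'M[R]_(n, d)).
Variables (K : finType) (rho : K -> T -> 'I_n).
Hypotheses (mA : random_matrix A) (mB : random_matrix B).
Hypothesis A2 : forall i j, (fun w => A w i j) \in Lfun P 2%:E.
Hypothesis B2 : forall i j, (fun w => B w i j) \in Lfun P 2%:E.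
Hypothesis urho : forall i, uniform_index P (rho i).
Hypothesis indX : independent_rvs P (draw_coord A B rho).
Variables (f : R -> R) (C : R).
Hypothesis lipf : C.-lipschitz f.

Let AB2 a b := Lfun2_mulmx mA mB A2 B2 (independent_entries indX) a b.
Let mX := measurable_draw_coord mA mB urho.

Definition sample (K' : finType) (h : K' -> K) a b (w : T) : R :=
  sample_entry h a b (draw_coord A B rho ^~ w).

Lemma measurable_sample (K' : finType) (h : K' -> K) a b :
  measurable_fun setT (sample h a b).
Proof.
exact: (measurableT_comp (measurable_sample_entry h a b) (measurable_rvec mX)).
Qed.

(** The sample is AB plus an error whose second moment is known exactly. *)
Lemma Lfun2_sample (K' : finType) (h : K' -> K) a b :
  (0 < #|K'|)%N -> injective h -> sample h a b \in Lfun P 2%:E.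
Proof.
move=> K'0 injh.
rewrite (_ : sample h a b = fun w =>
  (sample h a b w - (A w *m B w) a b) + (A w *m B w) a b); last first.
  by apply/funext => w; rewrite subrK.
apply: Lfun2D => //; apply: Lfun2P.
  apply: measurable_funB; first exact: measurable_sample.
  exact: Lfun_measurable (AB2 a b).
rewrite (expectation_sample_sqr mA mB A2 B2 urho indX K'0 injh).
exact: ltry.
Qed.

(** The gap is a positive multiple of an expected square; the existence of a draw is what yields its
    sign. *)
Lemma sample_gap_ge0 (K' : finType) (h : K' -> K) a b :
  (0 < #|K'|)%N -> injective h -> 0 <= sample_gap P A B a b.
Proof.
move=> K'0 injh.
have : (0 <= 'E_P[fun w => ((sample h a b w - (A w *m B w) a b) ^+ 2)%R])%E.
  by apply: expectation_ge0 => w; rewrite sqr_ge0.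
rewrite (expectation_sample_sqr mA mB A2 B2 urho indX K'0 injh) lee_fin.
by rewrite pmulr_rge0// invr_gt0 ltr0n.
Qed.

Lemma expectation_lip_sample (K' : finType) (h : K' -> K) a b :
    (0 < #|K'|)%N -> injective h ->
  ('E_P[fun w => ((f (sample h a b w) - f ((A w *m B w) a b)) ^+ 2)%R] <=
  (C ^+ 2 * (#|K'|%:R^-1 * sample_gap P A B a b))%:E)%E.
Proof.
move=> K'0 injh.
have := expectation_lipschitz_sqr lipf P (measurable_sample h a b)
  (Lfun_measurable (AB2 a b)).
by rewrite (expectation_sample_sqr mA mB A2 B2 urho indX K'0 injh) EFinM.
Qed.

Lemma sqr_mean_lip_sample (K' : finType) (h : K' -> K) a b :
    (0 < #|K'|)%N -> injective h ->
  fine ('E_P[fun w => (f (sample h a b w) - f ((A w *m B w) a b))%R])%E ^+ 2 <=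
  C ^+ 2 * (#|K'|%:R^-1 * sample_gap P A B a b).
Proof.
move=> K'0 injh.
have D2 := Lfun2B (Lfun2_lipschitz lipf (Lfun2_sample a b K'0 injh))
  (Lfun2_lipschitz lipf (AB2 a b)).
apply: (le_trans (sqr_expectation_le D2)).
rewrite -lee_fin fineK ?expectation_fin_num ?Lfun2_sqr//.
exact: expectation_lip_sample.
Qed.

Lemma variance_lip_sample (K' : finType) (h : K' -> K) a b :
    (0 < #|K'|)%N -> injective h ->
  ('V_P[fun w => (f (sample h a b w))%R] <=
  (2 * fine 'V_P[fun w => (f ((A w *m B w) a b))%R] +
   2 * (C ^+ 2 * (#|K'|%:R^-1 * sample_gap P A B a b)))%:E)%E.
Proof.
move=> K'0 injh.
have S2 := Lfun2_lipschitz lipf (Lfun2_sample a b K'0 injh).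
have F2 := Lfun2_lipschitz lipf (AB2 a b).
apply: (le_trans (variance_le_near F2 S2)).
rewrite [in leRHS]EFinD ![in leRHS](EFinM 2) fineK ?variance_fin_num// leeD2l//.
by rewrite lee_wpmul2l ?lee_fin// expectation_lip_sample.
Qed.

(** Both samples come from one draw and may be dependent, so only their errors against AB are used;
    these contribute 1/K1 and 1/K2 times the gap. *)
Lemma variance_lip_sampleB (K1 K2 : finType) (h1 : K1 -> K) (h2 : K2 -> K) a b :
    (0 < #|K1|)%N -> (0 < #|K2|)%N -> injective h1 -> injective h2 ->
  ('V_P[fun w => (f (sample h1 a b w) - f (sample h2 a b w))%R] <=
  (2 * C ^+ 2 * (#|K1|%:R^-1 + #|K2|%:R^-1) * sample_gap P A B a b)%:E)%E.
Proof.
move=> K10 K20 inj1 inj2.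
have S1 := Lfun2_sample a b K10 inj1.
have S2 := Lfun2_sample a b K20 inj2.
apply: (le_trans (variance_le_sqr
  (Lfun2B (Lfun2_lipschitz lipf S1) (Lfun2_lipschitz lipf S2)))).
apply: (le_trans (expectation_lipschitz_sqr lipf P
  (Lfun_measurable S1) (Lfun_measurable S2))).
rewrite [X in (_ <= X%:E)%E](_ : _ = C ^+ 2 *
  (2 * (#|K1|%:R^-1 + #|K2|%:R^-1) * sample_gap P A B a b)); last by ring.
rewrite [in leRHS]EFinM lee_wpmul2l ?lee_fin ?sqr_ge0//.
pose D1 w := sample h1 a b w - (A w *m B w) a b.
pose D2 w := sample h2 a b w - (A w *m B w) a b.
have D1L : D1 \in Lfun P 2%:E by exact: Lfun2B.
have D2L : D2 \in Lfun P 2%:E by exact: Lfun2B.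
apply: (@le_trans _ _ ('E_P[fun w => (2 * D1 w ^+ 2 + 2 * D2 w ^+ 2)%R])%E).
  rewrite !expectationE; apply: ge0_le_integral => //.
  - by move=> w _; rewrite lee_fin sqr_ge0.
  - apply/measurable_EFinP/measurable_funX/measurable_funB;
    exact: measurable_sample.
  - apply/measurable_EFinP/measurable_funD; apply: measurable_funM => //;
      apply: measurable_funX; [exact: Lfun_measurable D1L|].
    exact: Lfun_measurable D2L.
  move=> w _; rewrite lee_fin.
  rewrite (_ : sample h1 a b w - sample h2 a b w = D1 w - D2 w); last first.
    by rewrite /D1 /D2; ring.
  (* (D1 - D2)^2 + (D1 + D2)^2 = 2 D1^2 + 2 D2^2. *)
  by have := sqr_ge0 (D1 w + D2 w); nra.
rewrite expectationE; under eq_integral do rewrite EFinD !EFinM.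
rewrite integralD//=; last 2 first.
- by apply: integrableZl => //; exact: Lfun2_integrable_sqr.
- by apply: integrableZl => //; exact: Lfun2_integrable_sqr.
rewrite !integralZl//; try exact: Lfun2_integrable_sqr.
rewrite -!expectationE.
rewrite (expectation_sample_sqr mA mB A2 B2 urho indX K10 inj1).
rewrite (expectation_sample_sqr mA mB A2 B2 urho indX K20 inj2).
by rewrite -!EFinM -EFinD lee_fin le_eqVlt; apply/orP; left; apply/eqP; ring.
Qed.

End one_draw_bounds.

(** The variables of realisation [k] form the block of pairs [(k, x)]. Distinct blocks are disjoint,
    so the [N] terms are uncorrelated and their variances sum to at most N v, against a factor
    N^-2. *)
Lemma variance_mean_blocks (N : nat) (D : finType) (X : 'I_N * D -> T -> R)
    (G : rvec D R -> R) (v : R) :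
    (0 < N)%N -> (forall x, measurable_fun setT (X x)) -> independent_rvs P X ->
    measurable_fun setT G ->
    (forall k, (fun w => G (fun x => X (k, x) w)) \in Lfun P 2%:E) ->
    (forall k, 'V_P[fun w => (G (fun x => X (k, x) w))%R] <= v%:E)%E ->
  ('V_P[fun w => (N%:R^-1 * \sum_k G (fun x => X (k, x) w))%R] <=
   (N%:R^-1 * v)%:E)%E.
Proof.
move=> N0 mX indX mG G2 Gv.
rewrite (variance_mean_uncorrelated _ (X := fun k w => G (fun x => X (k, x) w)))//.
  apply: (@le_trans _ _ ((N%:R^-1 ^+ 2)%:E * \sum_(k < N) v%:E)%E).
    by rewrite lee_wpmul2l ?lee_fin ?sqr_ge0// lee_sum.
  rewrite sumEFin sumr_const card_ord -EFinM lee_fin -[v *+ N]mulr_natl mulrA.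
  by rewrite expr2 -[_ * _ * N%:R]mulrA mulVf ?mulr1// pnatr_eq0 -lt0n.
move=> i j ij.
apply: (covariance_blocks mX indX (h1 := pair i) (h2 := pair j)) => //.
- by move=> x y [].
- by move=> x y [].
- by move=> x y [ij'] _; rewrite ij' eqxx in ij.
Qed.

End estimator_bounds.

(** * The estimators as functions of the encoded draw *)

Section encodings.
Context {d0} {T : measurableType d0} {R : realType}.
Variable P : probability T R.
Context {m n d : nat}.
Local Notation entry := ('I_m * 'I_n + 'I_n * 'I_d)%type.
Implicit Types (A : T -> 'M[R]_(m, n)) (B : T -> 'M[R]_(n, d)).

Lemma entry_coord_events A B (e : entry) :
  preimage_set_system setT (entry_coord A B e) measurable `<=` entry_events A B e.
Proof. by case: e => -[i j]. Qed.

Lemma draw_coord_events K A B (r : nat -> T -> 'I_n) (x : entry + 'I_K) :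
  preimage_set_system setT (draw_coord A B (fun i : 'I_K => r i.+1) x) measurable
  `<=` draw_events A B r x.
Proof.
case: x => [e|i]; first exact: entry_coord_events.
(* On ['I_n] every subset is an event, in particular the set of indices whose code lies in [U]. *)
move=> _ [U mU <-]; exists [set j | U j%:R] => //.
Qed.

Lemma Z_entry M l (A : 'M[R]_(m, n)) (B : 'M[R]_(n, d)) (r : nat -> 'I_n) a b :
  Z M l A B r a b = n%:R / (M ^ l)%:R *
    \sum_(i < M ^ l) A a (r i.+1) * B (r i.+1) b.
Proof.
rewrite /Z mxE summxE big_add1/= big_mkord; congr (_ * _).
by apply: eq_bigr => i _; rewrite mxE big_ord1 !mxE.
Qed.

(* The 0-based position of [r (j.+1 * M)] in the fine sequence. *)
Lemma coarse_index_subproof M l (M_gt0 : (0 < M)%N) (j : 'I_(M ^ l)) :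
  ((j.+1 * M).-1 < M ^ l.+1)%N.
Proof. by rewrite prednK ?muln_gt0// expnSr leq_mul2r ltn_ord orbT. Qed.

Definition coarse_index M l (M_gt0 : (0 < M)%N) (j : 'I_(M ^ l)) :
  'I_(M ^ l.+1) := Ordinal (coarse_index_subproof M_gt0 j).

Lemma coarse_indexE M l (M_gt0 : (0 < M)%N) (j : 'I_(M ^ l)) :
  (coarse_index M_gt0 j).+1 = (j.+1 * M)%N.
Proof. by rewrite /= prednK// muln_gt0. Qed.

Lemma coarse_index_inj M l (M_gt0 : (0 < M)%N) :
  injective (@coarse_index M l M_gt0).
Proof.
move=> i j ij; apply/val_inj; have := coarse_indexE M_gt0 i.
by rewrite ij coarse_indexE => /eqP; rewrite eqn_pmul2r// eqSS => /eqP/esym.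
Qed.

Lemma P_hat_fine f M l A B (r : nat -> T -> 'I_n) a b w :
  P_hat f M l (A w) (B w) (fun i => r i w) a b =
  f (sample A B (fun i : 'I_(M ^ l) => r i.+1) id a b w).
Proof. by rewrite mxE Z_entry /sample sample_entryE card_ord. Qed.

(** The coarse estimator is a sample of the fine draw along [coarse_index], so a level difference is
    a function of a single block of variables. *)
Lemma P_hat_coarse f M l (M_gt0 : (0 < M)%N) A B (r : nat -> T -> 'I_n) a b w :
  P_hat f M l (A w) (B w) (fun j => r (j * M)%N w) a b =
  f (sample A B (fun i : 'I_(M ^ l.+1) => r i.+1) (@coarse_index M l M_gt0) a b w).
Proof.
rewrite mxE Z_entry /sample sample_entryE card_ord; congr (f (_ * _)).
by apply: eq_bigr => i _; rewrite coarse_indexE.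
Qed.

Lemma vec_variance_mean_le (N : nat) (D : finType) (X : 'I_N * D -> T -> R)
    (Y : T -> 'M[R]_(m, d)) (G : 'I_m -> 'I_d -> rvec D R -> R)
    (v : 'I_m -> 'I_d -> R) :
    (0 < N)%N -> (forall x, measurable_fun setT (X x)) -> independent_rvs P X ->
    (forall a b, measurable_fun setT (G a b)) ->
    (forall w a b, Y w a b = N%:R^-1 * \sum_k G a b (fun x => X (k, x) w)) ->
    (forall a b k, (fun w => G a b (fun x => X (k, x) w)) \in Lfun P 2%:E) ->
    (forall a b k, 'V_P[fun w => (G a b (fun x => X (k, x) w))%R] <= (v a b)%:E)%E ->
  (vec_variance P Y <= (N%:R^-1 * \sum_a \sum_b v a b)%:E)%E.
Proof.
move=> N0 mX indX mG YE G2 Gv.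
rewrite vec_varianceE; last first.
  move=> a b; under eq_fun do rewrite YE.
  apply: measurable_funM => //; apply: measurable_sum => k.
  exact: Lfun_measurable (G2 a b k).
rewrite mulr_sumr -sumEFin; apply: lee_sum => a _.
rewrite mulr_sumr -sumEFin; apply: lee_sum => b _.
under [X in variance _ X]eq_fun do rewrite YE.
exact: (variance_mean_blocks N0 mX indX (mG a b) (G2 a b) (Gv a b)).
Qed.

(** * Transfer of moments between copies of (A, B) *)

Section same_laws.
Variables (A A' : T -> 'M[R]_(m, n)) (B B' : T -> 'M[R]_(n, d)).
Hypotheses (mA : random_matrix A) (mB : random_matrix B).
Hypotheses (mA' : random_matrix A') (mB' : random_matrix B').
Hypothesis indE : independent_rvs P (entry_coord A B).
Hypothesis indE' : independent_rvs P (entry_coord A' B').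
Hypotheses (lA : same_entry_laws P A' A) (lB : same_entry_laws P B' B).
Hypothesis A2 : forall i j, (fun w => A w i j) \in Lfun P 2%:E.
Hypothesis B2 : forall i j, (fun w => B w i j) \in Lfun P 2%:E.

Let same g := @expectation_same_laws _ T R P m n d A A' B B' g
  mA mB mA' mB' indE indE' lA lB.

Lemma Lfun2_same_entry_l i j : (fun w => A' w i j) \in Lfun P 2%:E.
Proof.
apply: Lfun2P; first exact: mA'.
have := @same (fun x => x (inl (i, j)) ^+ 2).
rewrite /= => ->; last by apply: measurable_funX; exact: measurable_coord.
by rewrite -(fineK (expectation_fin_num (Lfun2_sqr (A2 i j)))) ltry.
Qed.

Lemma Lfun2_same_entry_r i j : (fun w => B' w i j) \in Lfun P 2%:E.
Proof.
apply: Lfun2P; first exact: mB'.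
have := @same (fun x => x (inr (i, j)) ^+ 2).
rewrite /= => ->; last by apply: measurable_funX; exact: measurable_coord.
by rewrite -(fineK (expectation_fin_num (Lfun2_sqr (B2 i j)))) ltry.
Qed.

Lemma expectation_same_mulmx (g : R -> R) a b : measurable_fun setT g ->
  ('E_P[fun w => (g ((A' w *m B' w) a b))%R] =
   'E_P[fun w => (g ((A w *m B w) a b))%R])%E.
Proof.
move=> mg; under eq_fun do rewrite -product_entryE.
under [in RHS]eq_fun do rewrite -product_entryE.
apply: (@same (fun x => g (product_entry a b x))).
by apply: (measurableT_comp mg); exact: measurable_product_entry.
Qed.

Lemma sample_gap_same a b : sample_gap P A' B' a b = sample_gap P A B a b.
Proof.
rewrite /sample_gap (@expectation_same_mulmx (fun x => x ^+ 2))//.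
congr (_ * _ - _); apply: eq_bigr => j _; congr fine.
apply: (@same (fun x => (x (inl (a, j)) * x (inr (j, b))) ^+ 2)).
by apply: measurable_funX; apply: measurable_funM; exact: measurable_coord.
Qed.

Lemma variance_same_mulmx (f : R -> R) (C : R) a b : C.-lipschitz f ->
  ('V_P[fun w => (f ((A' w *m B' w) a b))%R] =
   'V_P[fun w => (f ((A w *m B w) a b))%R])%E.
Proof.
move=> lipf; have mf := lipschitz_measurable lipf.
have AB2 := Lfun2_mulmx mA mB A2 B2 indE a b.
have AB2' := Lfun2_mulmx mA' mB' Lfun2_same_entry_l Lfun2_same_entry_r indE' a b.
rewrite (varianceE (Lfun2_lipschitz lipf AB2')).
rewrite (varianceE (Lfun2_lipschitz lipf AB2)).
rewrite (expectation_same_mulmx _ _ mf); congr (_ - _)%E.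
exact: (@expectation_same_mulmx (fun x => f x ^+ 2) _ _ (measurable_funX _ mf)).
Qed.

End same_laws.

End encodings.

(** * Averages over independent realisations *)

Section realisations.
Context {d0} {T : measurableType d0} {R : realType}.
Variable P : probability T R.
Context {m n d N K : nat}.
Variables (A : T -> 'M[R]_(m, n)) (B : T -> 'M[R]_(n, d)).
Variables (As : 'I_N -> T -> 'M[R]_(m, n)) (Bs : 'I_N -> T -> 'M[R]_(n, d)).
Variables (rs : 'I_N -> nat -> T -> 'I_n) (f : R -> R) (C : R).
Hypotheses (mA : random_matrix A) (mB : random_matrix B).
Hypothesis indE : independent_rvs P (entry_coord A B).
Hypothesis A2 : forall i j, (fun w => A w i j) \in Lfun P 2%:E.
Hypothesis B2 : forall i j, (fun w => B w i j) \in Lfun P 2%:E.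
Hypothesis lipf : C.-lipschitz f.
Hypotheses (N0 : (0 < N)%N) (K0 : (0 < K)%N).
Hypothesis ir : independent_realisations P K A B As Bs rs.

Let rho k (i : 'I_K) := rs k i.+1.
Let coord (x : 'I_N * ('I_m * 'I_n + 'I_n * 'I_d + 'I_K)) :=
  draw_coord (As x.1) (Bs x.1) (rho x.1) x.2.

Let mAs k : random_matrix (As k). Proof. by case: ir => /(_ k)[]. Qed.
Let mBs k : random_matrix (Bs k). Proof. by case: ir => /(_ k)[]. Qed.

Let urho k i : uniform_index P (rho k i).
Proof. by case: ir => _ _ /(_ k) u _; apply: u => /=. Qed.

Let ind_coord : independent_rvs P coord.
Proof.
case: ir => _ _ _ ind; apply: (mutually_independent_rvs ind) => -[k x].
exact: draw_coord_events.
Qed.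

Let m_coord x : measurable_fun setT (coord x).
Proof. exact: measurable_draw_coord. Qed.

Let ind_draw k : independent_rvs P (draw_coord (As k) (Bs k) (rho k)).
Proof. by apply: (independent_rvs_inj (h := pair k) _ ind_coord) => x y []. Qed.

Let indEs k := independent_entries (ind_draw k).
Let lA k : same_entry_laws P (As k) A. Proof. by case: ir => _ /(_ k)[]. Qed.
Let lB k : same_entry_laws P (Bs k) B. Proof. by case: ir => _ /(_ k)[]. Qed.

Let As2 k i j : (fun w => As k w i j) \in Lfun P 2%:E.
Proof.
exact: (Lfun2_same_entry_l mA mB (mAs k) (mBs k) indE (indEs k) (lA k) (lB k) A2).
Qed.

Let Bs2 k i j : (fun w => Bs k w i j) \in Lfun P 2%:E.
Proof.
exact: (Lfun2_same_entry_r mA mB (mAs k) (mBs k) indE (indEs k) (lA k) (lB k) B2).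
Qed.

Let gapE k a b : sample_gap P (As k) (Bs k) a b = sample_gap P A B a b.
Proof. exact: sample_gap_same. Qed.

Lemma sample_gap_realisation_ge0 a b : 0 <= sample_gap P A B a b.
Proof.
rewrite -(gapE (Ordinal N0)).
apply: (sample_gap_ge0 (mAs _) (mBs _) (As2 _) (Bs2 _) (urho _) (ind_draw _)
  (h := id)) => //.
by rewrite card_ord.
Qed.

(** The gap and the variance of each realisation equal those of (A, B) by equality of laws, so the
    bound speaks of (A, B) alone. *)
Lemma vec_variance_single (Y : T -> 'M[R]_(m, d)) :
    (forall w a b,
      Y w a b = N%:R^-1 * \sum_k f (sample (As k) (Bs k) (rho k) id a b w)) ->
  (vec_variance P Y <= (N%:R^-1 * \sum_a \sum_b
    (2 * fine ('V_P[fun w => (f ((A w *m B w) a b))%R])%E +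
     2 * (C ^+ 2 * (K%:R^-1 * sample_gap P A B a b))))%:E)%E.
Proof.
move=> YE; apply: (vec_variance_mean_le (X := coord)
  (G := fun a b x => f (sample_entry id a b x))) => //.
- move=> a b; apply: (measurableT_comp (lipschitz_measurable lipf)).
  exact: measurable_sample_entry.
- move=> a b k; apply: (Lfun2_lipschitz lipf).
  apply: (Lfun2_sample (mAs k) (mBs k) (As2 k) (Bs2 k) (urho k) (ind_draw k)) => //.
  by rewrite card_ord.
- move=> a b k; have cK : (0 < #|'I_K|)%N by rewrite card_ord.
  have := variance_lip_sample (mAs k) (mBs k) (As2 k) (Bs2 k) (urho k)
    (ind_draw k) lipf a b cK (@inj_id 'I_K).
  rewrite gapE card_ord.
  by rewrite (variance_same_mulmx mA mB (mAs k) (mBs k) indE (indEs k)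
    (lA k) (lB k) A2 B2 a b lipf).
Qed.

(** Here [h] thins the index sequence; being injective, it again yields independent uniform indices,
    K' of them. *)
Lemma vec_variance_difference (K' : nat) (h : 'I_K' -> 'I_K)
    (Y : T -> 'M[R]_(m, d)) :
    (0 < K')%N -> injective h ->
    (forall w a b, Y w a b = N%:R^-1 * \sum_k
      (f (sample (As k) (Bs k) (rho k) id a b w) -
       f (sample (As k) (Bs k) (rho k) h a b w))) ->
  (vec_variance P Y <= (N%:R^-1 * \sum_a \sum_b
    (2 * C ^+ 2 * (K%:R^-1 + K'%:R^-1) * sample_gap P A B a b))%:E)%E.
Proof.
move=> K'0 injh YE; apply: (vec_variance_mean_le (X := coord)
  (G := fun a b x => f (sample_entry id a b x) - f (sample_entry h a b x))) => //.
- move=> a b; apply: measurable_funB;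
  apply: (measurableT_comp (lipschitz_measurable lipf));
  exact: measurable_sample_entry.
- move=> a b k; apply: Lfun2B; apply: (Lfun2_lipschitz lipf);
  apply: (Lfun2_sample (mAs k) (mBs k) (As2 k) (Bs2 k) (urho k) (ind_draw k)) => //;
  by rewrite card_ord.
- move=> a b k; have cK : (0 < #|'I_K|)%N by rewrite card_ord.
  have cK' : (0 < #|'I_K'|)%N by rewrite card_ord.
  have := variance_lip_sampleB (mAs k) (mBs k) (As2 k) (Bs2 k) (urho k)
    (ind_draw k) lipf a b cK cK' (@inj_id 'I_K) injh.
  by rewrite gapE !card_ord.
Qed.

End realisations.

(** * Bias, variance and complexity bounds *)

Theorem corollary3p4 (R : realType) (disp : measure_display)
    (T : measurableType disp) (Pr : probability T R) (m n d : nat)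
    (A : T -> 'M[R]_(m, n)) (B : T -> 'M[R]_(n, d))
    (rmA : random_matrix A) (rmB : random_matrix B)
    (indepAB : mutually_independent Pr (entry_events A B))
    (momA : forall j, col_moment Pr A j \is a fin_num /\ col_moment Pr A j != 0%E)
    (momB : forall j, row_moment Pr B j \is a fin_num /\ row_moment Pr B j != 0%E)
    (f : R -> R) (Cf : R) (lipf : Cf.-lipschitz f) (M : nat) (M_ge1 : (1 <= M)%N) :
  let mu := mu_bar Pr A B in
  let nu := nu_bar Pr A B in
  let P := fun w => map_mx f (A w *m B w) in
  let c1 := Cf * Num.sqrt (n%:R * nu + mu) in
  let c2 := 2 * Cf ^+ 2 * (M%:R + 1) * (n%:R * nu + mu)
            + 2 * fine (vec_variance Pr P) in
  let c3 : R := m%:R * d%:R * (1 + M%:R^-1) in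
  [/\ forall (l : nat) (r : nat -> T -> 'I_n),
        uniform_indices Pr (M ^ l) r ->
        mutually_independent Pr (draw_events (K := M ^ l) A B r) ->
        norm2 (vec (mean Pr (fun w =>
          P_hat f M l (A w) (B w) (fun i => r i w) - P w))) ^+ 2
        <= c1 ^+ 2 * M%:R ^- l,
      (forall (l N : nat) (As : 'I_N -> T -> 'M[R]_(m, n))
              (Bs : 'I_N -> T -> 'M[R]_(n, d)) (rs : 'I_N -> nat -> T -> 'I_n),
        (1 <= N)%N -> independent_realisations Pr (M ^ l) A B As Bs rs ->
        (vec_variance Pr (Y_hat f M l As Bs rs)
         <= (c2 * N%:R^-1 * M%:R ^- l)%:E)%E) /\
      (forall (L N : nat) (As : 'I_N -> T -> 'M[R]_(m, n))
              (Bs : 'I_N -> T -> 'M[R]_(n, d)) (rs : 'I_N -> nat -> T -> 'I_n),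
        (1 <= N)%N -> independent_realisations Pr (M ^ L) A B As Bs rs ->
        (vec_variance Pr (MC_hat f M L As Bs rs) <= (c2 * N%:R^-1)%:E)%E)
    & (forall l N : nat, (1 <= N)%N ->
        (level_cost m d M l N)%:R <= c3 * N%:R * M%:R ^+ l) /\
      (forall L N : nat, (1 <= N)%N ->
        (MC_cost m d M L N)%:R <= c3 * N%:R * M%:R ^+ L)].
Proof.
move=> mu nu P c1 c2 c3.
have M0 : (0 < M)%N by [].
have MR0 : 0 < M%:R :> R by rewrite ltr0n.
have finA j : col_moment Pr A j \is a fin_num by case: (momA j).
have finB j : row_moment Pr B j \is a fin_num by case: (momB j).
have A2 i j : (fun w => A w i j) \in Lfun Pr 2%:E by exact: Lfun2_col_moment.
have B2 i j : (fun w => B w i j) \in Lfun Pr 2%:E by exact: Lfun2_row_moment.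
have indE : independent_rvs Pr (entry_coord A B).
  exact: (mutually_independent_rvs indepAB (@entry_coord_events _ _ _ _ _ _ A B)).
have gapE := sum_sample_gap rmA rmB finA finB indE.
set S := n%:R * nu + mu in c1 c2 *; rewrite -/nu -/mu -/S in gapE.
have F2 a b : (fun w => f ((A w *m B w) a b)) \in Lfun Pr 2%:E.
  exact/(Lfun2_lipschitz lipf)/Lfun2_mulmx.
have PE w a b : P w a b = f ((A w *m B w) a b) by rewrite [LHS]mxE.
have mP : random_matrix P.
  by move=> a b; under eq_fun do rewrite PE; exact: Lfun_measurable (F2 a b).
(* All entry variances are finite, so [fine] commutes with the double sum. *)
have VE : \sum_a \sum_b fine ('V_Pr[fun w => (f ((A w *m B w) a b))%R])%E =
    fine (vec_variance Pr P).
  have VPE a b : ('V_Pr[fun w => (P w a b)%R] =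
      'V_Pr[fun w => (f ((A w *m B w) a b))%R])%E.
    by congr (variance _ _); apply/funext => w; rewrite PE.
  have fV a b : ('V_Pr[fun w => (P w a b)%R])%E \is a fin_num.
    by rewrite VPE variance_fin_num.
  rewrite vec_varianceE// -sum_fine => [|a _].
    apply: eq_bigr => a _; rewrite -sum_fine//; apply: eq_bigr => b _.
    by rewrite VPE.
  by rewrite sum_fin_num; apply/allP => _ /mapP[b _ ->]; exact: fV.
have V0 : 0 <= fine (vec_variance Pr P).
  by rewrite -VE !sumr_ge0// => a _; rewrite sumr_ge0// => b _;
    rewrite fine_ge0// variance_ge0.
have C20 : 0 <= 2 * Cf ^+ 2 by apply: mulr_ge0 => //; exact: sqr_ge0.
have gap_sumE c : \sum_a \sum_b c * sample_gap Pr A B a b = c * S.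
  by rewrite -gapE mulr_sumr; apply: eq_bigr => a _; rewrite mulr_sumr.
have K0 l : (0 < M ^ l)%N by rewrite expn_gt0 M0.
have invK l : (M ^ l)%:R^-1 = M%:R ^- l :> R by rewrite natrX.
have invK0 l : 0 <= M%:R ^- l :> R by rewrite invr_ge0 exprn_ge0.
(* Serves both [MC_hat] and [Y_hat] at level 0, which average the same single-level estimator. *)
have single_bound l N (As : 'I_N -> T -> 'M[R]_(m, n))
    (Bs : 'I_N -> T -> 'M[R]_(n, d)) (rs : 'I_N -> nat -> T -> 'I_n)
    (Y : T -> 'M[R]_(m, d)) :
    (1 <= N)%N -> independent_realisations Pr (M ^ l) A B As Bs rs ->
    (forall w, Y w = N%:R^-1 *: \sum_k
      P_hat f M l (As k w) (Bs k w) (fun i => rs k i w)) ->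
    (vec_variance Pr Y <= (c2 * N%:R^-1)%:E)%E.
  move=> N1 ir YE.
  (* [S] is a sum of gaps, and a realisation is at hand to show each of them nonnegative. *)
  have S0 : 0 <= S.
    rewrite -gapE !sumr_ge0// => a _; rewrite sumr_ge0// => b _.
    exact: (sample_gap_realisation_ge0 rmA rmB indE A2 B2 N1 (K0 l) ir).
  apply: le_trans (vec_variance_single rmA rmB indE A2 B2 lipf N1 (K0 l) ir _) _.
    move=> w a b; rewrite YE mxE summxE; congr (_ * _); apply: eq_bigr => k _.
    by rewrite P_hat_fine.
  rewrite lee_fin [leRHS]mulrC ler_wpM2l ?invr_ge0//.
  under eq_bigr do rewrite big_split/= -mulr_sumr.
  rewrite big_split/= -mulr_sumr VE.
  under [X in _ + X]eq_bigr do under eq_bigr do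
    rewrite [Cf ^+ 2 * (_ * _)]mulrA [2 * (_ * _)]mulrA [2 * (_ * _)]mulrA.
  rewrite gap_sumE invK /c2 addrC lerD2r ler_wpM2r// ler_wpM2l//.
  (* M^-l <= 1 <= M + 1 absorbs the sampling error into the first term of [c2]. *)
  apply: (@le_trans _ _ 1); last by rewrite lerDr ler0n.
  by rewrite invf_le1 ?exprn_gt0// exprn_ege1// ler1n.
split.
- move=> l r ur ind.
  have indX : independent_rvs Pr (draw_coord A B (fun i : 'I_(M ^ l) => r i.+1)).
    exact: (mutually_independent_rvs ind (@draw_coord_events _ _ _ _ _ _ _ A B r)).
  have urho (i : 'I_(M ^ l)) : uniform_index Pr (r i.+1) by apply: ur => /=.
  have cK : (0 < #|'I_(M ^ l)|)%N by rewrite card_ord.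
  have S0 : 0 <= S.
    rewrite -gapE !sumr_ge0// => a _; rewrite sumr_ge0// => b _.
    exact: (sample_gap_ge0 rmA rmB A2 B2 urho indX a b cK (@inj_id _)).
  (* Since [0 <= S], the squared root in [c1] is [S], which is then spread over the entries as a sum
     of gaps. *)
  rewrite norm2_vec_sqr /c1 exprMn sqr_sqrtr// mulrAC -gap_sumE.
  apply: ler_sum => a _; apply: ler_sum => b _; rewrite [X in X ^+ 2]mxE.
  rewrite (_ : (fun w => _) = fun w =>
      f (sample A B (fun i : 'I_(M ^ l) => r i.+1) id a b w) -
      f ((A w *m B w) a b)); last first.
    by apply/funext => w; rewrite [LHS]mxE P_hat_fine [X in _ + X]mxE PE.
  have := sqr_mean_lip_sample rmA rmB A2 B2 urho indX lipf a b cK (@inj_id _).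
  by rewrite card_ord invK mulrA.
- split=> [l N As Bs rs N1 ir|L N As Bs rs N1 ir]; last first.
    exact: single_bound N1 ir _.
  (* Level 0 has no coarse term and falls under the single-level bound, with M^0 = 1. *)
  case: l ir => [|l] ir.
    by rewrite expr0 invr1 mulr1; exact: single_bound N1 ir _.
  have S0 : 0 <= S.
    rewrite -gapE !sumr_ge0// => a _; rewrite sumr_ge0// => b _.
    exact: (sample_gap_realisation_ge0 rmA rmB indE A2 B2 N1 (K0 l.+1) ir).
  apply: le_trans (vec_variance_difference rmA rmB indE A2 B2 lipf N1
    (K0 l.+1) ir (K0 l) (@coarse_index_inj M l M0) _) _.
    move=> w a b; rewrite mxE summxE; congr (_ * _); apply: eq_bigr => k _.
    by rewrite mxE [X in _ + X]mxE P_hat_fine (P_hat_coarse _ _ M0).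
  rewrite lee_fin gap_sumE [leRHS]mulrAC [leRHS]mulrC ler_wpM2l ?invr_ge0//.
  (* The coarse sample is M times smaller: M^-(l+1) + M^-l = (M + 1) M^-(l+1), the factor in
     [c2]. *)
  rewrite !invK; have -> : M%:R ^- l = M%:R * M%:R ^- l.+1 :> R.
    by rewrite exprS invfM mulrA divff ?mul1r// gt_eqF.
  rewrite /c2 [leRHS]mulrDl -[leLHS]addr0 lerD ?mulr_ge0//.
  by rewrite le_eqVlt; apply/orP; left; apply/eqP; ring.
- split=> [l N N1|L N N1].
    case: l => [|l]; rewrite /level_cost /eval_cost /c3.
      (* Level 0 costs m d N, and 1 + M^-1 >= 1. *)
      rewrite expn0 expr0 muln1 mulr1 !natrM mulrC ler_wpM2r ?ler0n//.
      by rewrite ler_peMr ?mulr_ge0 ?ler0n// lerDl invr_ge0 ler0n.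
    (* At level l + 1 the bound is an equality: M^(l+1) + M^l = (1 + M^-1) M^(l+1), the origin of
       [c3]. *)
    rewrite !(natrM, natrD) !natrX le_eqVlt; apply/orP; left; apply/eqP.
    by rewrite exprS; field; rewrite gt_eqF.
  rewrite /MC_cost /eval_cost /c3 !natrM natrX mulrA ler_wpM2r ?exprn_ge0//.
  rewrite mulrC ler_wpM2r ?ler0n//.
  by rewrite ler_peMr ?mulr_ge0 ?ler0n// lerDl invr_ge0 ler0n.
Qed.
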